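(* Let $M$ be an $n$-dimensional triangulated piecewise Euclidean manifold (possibly with boundary). Then $M$ is discretely conformally flat if and only if every interior vertex $v_0$ of $M$ satisfies the following condition: there exists a convex polytope in $\mathbb{R}^n$ whose boundary is triangulated by a simplicial complex combinatorially equivalent to the link of $v_0$ (via a bijection of vertices $v_i \mapsto p_i$), such that for every edge $[v_i,v_j]$ of the link of $v_0$ the corresponding edge has length $$|p_i-p_j| = \tilde\ell_{ij} = \frac{\ell_{ij}}{\ell_{0i}\,\ell_{0j}},$$ where $\ell_{ij}$ denotes the length in $M$ of the edge between adjacent vertices $v_i,v_j$ of $M$.
   Context: A triangulated piecewise Euclidean manifold is an $n$-manifold (possibly with boundary) obtained by gluing Euclidean $n$-simplices along their $(n-1)$-faces by isometries, together with the resulting triangulation (simplicial complex structure); each edge $[v_i,v_j]$ then has a length $\ell_{ij}$. The vertex star of a vertex $v$ is the union of all closed simplices containing $v$, and the link of $v$ is the subcomplex of simplices of the star not containing $v$. Two such triangulated objects with vertex sets $V,V'$ are discretely conformally equivalent if there is a combinatorial isomorphism $\phi:V\to V'$ (a vertex bijection such that vertex sets span simplices in one exactly when their images span simplices in the other) and a function $u:V\to\mathbb{R}$ such that for every edge $[v_1,v_2]$, $\ell'(\phi(v_1),\phi(v_2)) = e^{\frac12(u(v_1)+u(v_2))}\ell(v_1,v_2)$. A discrete domain is a locally finite simplicial complex $K$ in $\mathbb{R}^n$ such that: (i) $K$ is pure $n$-dimensional; (ii) every $n$-simplex of $K$ has at least one vertex in the interior of the carrier $|K|$; (iii) the subgraph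 of the 1-skeleton of $K$ induced by the interior vertices is connected. It is locally Delaunay if for every $n$-simplex $\sigma\in K$, the open ball bounded by the circumsphere of $\sigma$ contains no vertex of any $n$-simplex of $K$ sharing an $(n-1)$-face with $\sigma$. A triangulated piecewise Euclidean manifold is discretely conformally flat if the vertex star of every interior vertex is discretely conformally equivalent to a locally Delaunay discrete domain in $\mathbb{R}^n$. *)

(* Defs.v *)
From HB Require Import structures.
From mathcomp Require Import all_boot all_order all_algebra.
From mathcomp Require Import finmap.
From mathcomp Require Import classical_sets boolp cardinality reals sequences exp.

Set Implicit Arguments.
Unset Strict Implicit.
Unset Printing Implicit Defensive.

Import Order.TTheory GRing.Theory Num.Theory.
Local Open Scope classical_set_scope.
Local Open Scope ring_scope.
Local Open Scope fset_scope.

Section Defs.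
Variable R : realType.
Variable n : nat.

Definition pt := 'rV[R]_n.

Definition edist (p q : pt) : R :=
  Num.sqrt (\sum_(i < n) (p ord0 i - q ord0 i) ^+ 2).

(* closed half-space H^n = {x | x_0 >= 0} (all of R^0 when n = 0) *)
Definition halfspace : set pt :=
  [set z | forall i : 'I_n, val i = 0%N -> 0 <= z ord0 i].

Definition interior_pt (A : set pt) (x : pt) : Prop :=
  exists2 d : R, 0 < d & forall y, edist x y < d -> A y.
Definition closure_pt (A : set pt) (x : pt) : Prop :=
  forall d : R, 0 < d -> exists2 y, A y & edist x y < d.
Definition boundary_pt (A : set pt) : set pt :=
  [set x | closure_pt A x /\ ~ interior_pt A x].

Definition open_in (X W : set pt) : Prop :=
  (W `<=` X)%classic /\ forall z, W z -> exists2 d : R, 0 < d &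
    forall z', X z' -> edist z z' < d -> W z'.

Definition conv (S : {fset pt}) : set pt :=
  [set x | exists lam : pt -> R,
     (forall p, p \in S -> 0 <= lam p) /\
     \sum_(p <- S) lam p = 1 /\ x = \sum_(p <- S) lam p *: p].

Definition aff_indep_fam (V : choiceType) (s : {fset V}) (q : V -> pt) : Prop :=
  forall lam : V -> R, \sum_(v <- s) lam v = 0 ->
    \sum_(v <- s) lam v *: q v = 0 -> forall v, v \in s -> lam v = 0.

Definition vertices (V : choiceType) (K : set {fset V}) : set V :=
  [set v | K [fset v]].

Section Abstract.
Variable V : choiceType.
Implicit Types (K : set {fset V}).

Definition simplicial_complex K : Prop :=
  (forall s, K s -> s != fset0) /\
  (forall s t, K s -> fsubset t s -> t != fset0 -> K t).


Definition locally_finite K : Prop :=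
  forall v : V, finite_set [set s | K s /\ v \in s].

Definition vstar K (v : V) : set {fset V} :=
  [set s | K s /\ exists t, K t /\ v \in t /\ fsubset s t].
Definition vlink K (v : V) : set {fset V} :=
  [set s | vstar K v s /\ v \notin s].

Definition comb_iso (W : choiceType) K (L : set {fset W}) (phi : V -> W) : Prop :=
  [/\ forall a b, vertices K a -> vertices K b -> phi a = phi b -> a = b,
      forall a, vertices K a -> vertices L (phi a),
      forall p, vertices L p -> exists2 a, vertices K a & phi a = p &
      forall S : {fset V}, (forall a, a \in S -> vertices K a) ->
        (K S <-> L [fset phi a | a in S])].

(* geometric realisation |K| as barycentric-coordinate functions *)
Definition realization K : set (V -> R) :=
  [set x | (forall v, 0 <= x v) /\ exists s, K s /\
     (forall v, v \notin s -> x v = 0) /\ \sum_(v <- s) x v = 1].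

(* sup-metric ball in |K| (differences of points of |K| are finitely
   supported, so this is the open ball of the sup metric) *)
Definition rball K (x : V -> R) (e : R) : set (V -> R) :=
  [set y | realization K y /\ forall v, `|x v - y v| < e].

Definition chart_at K (x : V -> R) (X : set pt) : Prop :=
  exists2 e : R, 0 < e & exists (f : (V -> R) -> pt) (g : pt -> (V -> R)),
   let B := rball K x e in let W := (f @` B)%classic in
   [/\ open_in X W,
       forall y, B y -> g (f y) = y,
       (forall y, B y -> forall eps : R, 0 < eps -> exists2 d : R, 0 < d &
          forall y', B y' -> (forall v, `|y v - y' v| < d) -> edist (f y) (f y') < eps) &
       (forall z, W z -> forall eps : R, 0 < eps -> exists2 d : R, 0 < d &
          forall z', W z' -> edist z z' < d -> forall v, `|g z v - g z' v| < eps)].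

Definition vertex_point (v : V) : V -> R := fun w => if w == v then 1 else 0.

Definition euclidean_simplex (l : V -> V -> R) (s : {fset V}) : Prop :=
  exists q : V -> pt, aff_indep_fam s q /\
    forall a b, a \in s -> b \in s -> edist (q a) (q b) = l a b.

Definition tri_PE_manifold K (l : V -> V -> R) : Prop :=
  [/\ simplicial_complex K /\ locally_finite K,
      forall s, K s -> exists t, K t /\ fsubset s t /\ #|` t| = n.+1,
      forall s, K s -> (#|` s| <= n.+1)%N,
      forall s, K s -> #|` s| = n.+1 -> euclidean_simplex l s &
      forall x, realization K x -> chart_at K x halfspace].

Definition interior_vertex K (v : V) : Prop :=
  vertices K v /\ chart_at K (vertex_point v) setT.
End Abstract.

Implicit Types (L : set {fset pt}).

Definition geom_complex L : Prop :=
  [/\ simplicial_complex L,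
      forall s, L s -> aff_indep_fam s id,
      forall s t, L s -> L t -> (conv s `&` conv t)%classic = conv (fsetI s t) &
      forall x : pt, exists2 d : R, 0 < d &
        finite_set [set s | L s /\ exists2 y, conv s y & edist x y < d]].

Definition carrier L : set pt := \bigcup_(s in L) conv s.

Definition discrete_domain L : Prop :=
  [/\ geom_complex L,
      forall s, L s -> exists t, L t /\ fsubset s t /\ #|` t| = n.+1,
      forall s, L s -> #|` s| = n.+1 -> exists2 v, v \in s & interior_pt (carrier L) v &
      forall a b, vertices L a -> interior_pt (carrier L) a ->
                  vertices L b -> interior_pt (carrier L) b ->
        exists (k : nat) (w : nat -> pt), [/\ w 0%N = a, w k = b,
          forall i, (i <= k)%N -> vertices L (w i) /\ interior_pt (carrier L) (w i) &
          forall i, (i < k)%N -> L [fset w i; w i.+1]]].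

Definition locally_delaunay L : Prop :=
  forall s t, L s -> L t -> #|` s| = n.+1 -> #|` t| = n.+1 ->
    #|` fsetI s t| = n ->
    forall (c : pt) (r : R), (forall p, p \in s -> edist c p = r) ->
      forall w, w \in t -> ~ (edist c w < r).

Definition disc_conf_equiv (V : choiceType) (K : set {fset V})
    (l : V -> V -> R) L : Prop :=
  exists (phi : V -> pt) (u : V -> R), comb_iso K L phi /\
    forall a b, K [fset a; b] -> a != b ->
      edist (phi a) (phi b) = expR ((u a + u b) / 2) * l a b.

Definition disc_conf_flat (V : choiceType) (K : set {fset V})
    (l : V -> V -> R) : Prop :=
  forall v, interior_vertex K v ->
    exists L, [/\ discrete_domain L, locally_delaunay L &
                  disc_conf_equiv (vstar K v) l L].

Definition link_polytope_cond (V : choiceType) (K : set {fset V})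
    (l : V -> V -> R) (v0 : V) : Prop :=
  exists (F : {fset pt}) (L : set {fset pt}) (p : V -> pt),
    [/\ F != fset0, geom_complex L, comb_iso (vlink K v0) L p,
        carrier L = boundary_pt (conv F) &
        forall a b, vlink K v0 [fset a; b] -> a != b ->
          edist (p a) (p b) = l a b / (l v0 a * l v0 b)].
End Defs.

(* Main.v *)
From HB Require Import structures.
From mathcomp Require Import all_boot all_order all_algebra ring lra.
From mathcomp Require Import finmap.
From mathcomp Require Import classical_sets boolp cardinality reals sequences exp.
From mathcomp Require Import filter set_interval topology normedtype.
Require Import Defs.

(* Inverting the star of an interior vertex v0 in a sphere centred at v0 turns
   each n-simplex of the star into a simplicial cone over a face of the inverted
   link, its circumsphere (which passes through v0) into the hyperplane spanned
   by that face, and "outside the circumsphere" into "on the side of v0".  So the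
   local Delaunay condition says that the inverted link is locally convex along
   its ridges; walking through the fan of cones along a generic segment turns
   this into global convexity.  The scaling of lengths under inversion is exactly
   l_ij / (l_0i l_0j) up to conformal factors.  Conversely a polytope is inverted
   about any interior point.

   A polytope with empty interior has to be excluded for an interior vertex: the
   link is then a flat (n-1)-ball, so some facet of the star through v0 lies in a
   single n-simplex, and near it the manifold is a half-space.  A chart there
   would give a nowhere vanishing map of a cube that is the identity on the
   boundary, against the Poincare-Miranda theorem.  That theorem is obtained from
   a mod 2 cup product of the sign functions of the components on a grid. *)

Set Implicit Arguments.
Unset Strict Implicit.
Unset Printing Implicit Defensive.
Import Order.TTheory GRing.Theory Num.Theory.
Import numFieldNormedType.Exports.
Local Open Scope fset_scope.
Local Open Scope ring_scope.

(** * A discrete Poincare-Miranda theorem *)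

(** Embeddings are handled through coefficient functions on abstract vertices: uniqueness of
    nonnegative (or convex) coefficients replaces statements about intersecting cones and simplices.
    Seen from its centre, an inversion only rescales the generators of the cones, so the fan
    survives it. Dual bases turn walls into linear functionals, and the sum of a dual basis is the
    functional equal to 1 on the face. The walk asks only that every wall have a cone on its other
    side, and it serves twice: along it the Delaunay inequality accumulates to global support, and
    in the flat case it would reach a direction that no cone contains, so some ridge must be free.
    The flat case arises because the boundary is closure minus interior: a hull without interior
    lies in its own boundary, so the carrier condition alone allows a triangulated flat hull. The
    squared radius of the inversion is [expR (u v0)] in one direction and 1 in the other, where the
    conformal factor is read off from the edges at [v0]. *)

Section CupProduct.
Variable n : nat.
Implicit Types (x y : {ffun 'I_n -> nat}) (j k : 'I_n) (S : {set 'I_n}).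

Definition gstep x j : {ffun 'I_n -> nat} := [ffun k => (x k + (k == j))%N].
Definition gset x j (t : nat) : {ffun 'I_n -> nat} :=
  [ffun k => if k == j then t else x k].

Lemma gstepC x j k : gstep (gstep x j) k = gstep (gstep x k) j.
Proof. by apply/ffunP=> i; rewrite !ffunE addnAC. Qed.

Lemma gsetC x j k s t : j != k -> gset (gset x j s) k t = gset (gset x k t) j s.
Proof.
move=> jk; apply/ffunP=> i; rewrite !ffunE.
by case: (eqVneq i k) => // ->; rewrite eq_sym (negbTE jk).
Qed.

Lemma gset_step x j t : gstep (gset x j t) j = gset x j t.+1.
Proof. by apply/ffunP=> i; rewrite !ffunE; case: eqP => _; rewrite ?addn1 ?addn0. Qed.

Lemma gset_stepC x j k t : j != k -> gstep (gset x j t) k = gset (gstep x k) j t.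
Proof.
move=> jk; apply/ffunP=> i; rewrite !ffunE.
by case: (eqVneq i j) => // ->; rewrite (negbTE jk) addn0.
Qed.

(* Cup product of the coboundaries of the functions in [A], evaluated on the cube
   with lowest corner [x] and directions [S]; mod 2, so no orientations. *)
Fixpoint cup (A : seq ({ffun 'I_n -> nat} -> 'F_2)) S x : 'F_2 :=
  if A is a :: B then
    \sum_(j in S) (a (gstep x j) - a x) * cup B (S :\ j) (gstep x j)
  else 1.

Lemma F2_addrr (z : 'F_2) : z + z = 0.
Proof. by rewrite -mulr2n -mulr_natr pchar_Zp // mulr0. Qed.

(** Modulo 2 the terms of [(j, k)] and [(k, j)] cancel; this does the work of the alternating signs
    in the boundary of a boundary. *)
Lemma sum_sym_F2 S (f : 'I_n -> 'I_n -> 'F_2) :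
  (forall j k, f j k = f k j) -> \sum_(j in S) \sum_(k in S :\ j) f j k = 0.
Proof.
move=> fC.
have -> : \sum_(j in S) \sum_(k in S :\ j) f j k =
  \sum_(j in S) (\sum_(k in S | (k < j)%N) f j k + \sum_(k in S | (j < k)%N) f j k).
  apply: eq_bigr => j jS; rewrite (bigID (fun k : 'I_n => (k < j)%N)) /=.
  congr (_ + _); apply: eq_bigl => k; rewrite !inE -(inj_eq val_inj) /=;
    by case: ltngtP; rewrite ?andbF ?andbT.
rewrite big_split /= [X in _ + X](exchange_big_dep (mem S)) /=; last by move=> i j _ /andP[].
rewrite -[RHS](F2_addrr (\sum_(j in S) \sum_(k in S | (k < j)%N) f j k)).
congr (_ + _); apply: eq_bigr => j jS.
by apply: eq_big => [k|k _]; rewrite ?jS //; exact: fC.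
Qed.

(** A product of coboundaries is a cocycle. The sum over two directions splits into a part symmetric
    in them, which vanishes modulo 2, and for each [k] the same sum for the shorter product on
    [S :\ k]. *)
Lemma cup_closed A S x :
  \sum_(j in S) (cup A (S :\ j) (gstep x j) - cup A (S :\ j) x) = 0.
Proof.
elim: A S x => [|a B IH] S x /=; first by rewrite big1 // => j _; rewrite subrr.
pose W j k := cup B (S :\ j :\ k).
have WC j k : W j k = W k j by rewrite /W !finset.setDDl [in RHS]finset.setUC.
transitivity (\sum_(j in S) \sum_(k in S :\ j)
  ((a (gstep (gstep x j) k) - a (gstep x j) - a (gstep x k) + a x)
     * W j k (gstep (gstep x j) k)
   + (a (gstep x k) - a x) * (W j k (gstep (gstep x k) j) - W j k (gstep x k)))).
  apply: eq_bigr => j _; rewrite -sumrB; apply: eq_bigr => k _.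
  by rewrite (gstepC x k j); rewrite -/(W j k); ring.
rewrite (eq_bigr _ (fun j _ => big_split _ _ _ _ _)) /= big_split /=.
rewrite sum_sym_F2 ?add0r; last first.
  by move=> j k; rewrite WC (gstepC x j k); ring.
rewrite (exchange_big_dep (mem S)) /=; last by move=> j k _; rewrite !inE => /andP[].
rewrite big1 // => k kS; rewrite -mulr_sumr.
rewrite (eq_bigl (fun j => j \in S :\ k)); last first.
  by move=> j; rewrite !inE eq_sym andbCA kS andbT.
under eq_bigr => j _ do rewrite WC.
by rewrite IH mulr0.
Qed.

(** Adding a multiple of the vanishing sum of [cup_closed] exhibits the product as the coboundary of
    [a] times the shorter product, so that sums over a box telescope to its faces. *)
Lemma cup_stokes a A S x :
  cup (a :: A) S x =
  \sum_(j in S) (a (gstep x j) * cup A (S :\ j) (gstep x j) - a x * cup A (S :\ j) x).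
Proof.
transitivity (cup (a :: A) S x +
  a x * \sum_(j in S) (cup A (S :\ j) (gstep x j) - cup A (S :\ j) x)).
  by rewrite cup_closed mulr0 addr0.
by rewrite mulr_sumr -big_split /=; apply: eq_bigr => j _; rewrite -/(cup A _ _); ring.
Qed.

(** No step of the cube leaves the slice, where [A k] is constant, so the difference contributed by
    [A k] is zero. *)
Lemma cup_slice k c v (A : 'I_n -> {ffun 'I_n -> nat} -> 'F_2) s S x :
  (forall y, y k = c -> A k y = v) -> k \in s -> k \notin S -> x k = c ->
  cup (map A s) S x = 0.
Proof.
move=> Ak; elim: s S x => // i s IH S x /=.
have stepk j y : j \in S -> k \notin S -> y k = c -> gstep y j k = c.
  by move=> jS kS yk; rewrite ffunE yk; case: eqP => [e|]; rewrite ?addn0 // e jS in kS *.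
rewrite inE => /orP[/eqP <-|ks] kS xk; rewrite big1 // => j jS.
  by rewrite !Ak ?subrr ?mul0r // stepk.
by rewrite IH ?mulr0 // ?stepk // !inE (negbTE kS) andbF.
Qed.

Lemma cup_neq0 A S x : cup A S x != 0 -> forall i, (i < size A)%N ->
  exists y z : {ffun 'I_n -> nat}, [/\ forall j, (x j <= y j <= x j + (j \in S))%N,
    forall j, (x j <= z j <= x j + (j \in S))%N &
    nth (fun _ => 0) A i y != nth (fun _ => 0) A i z].
Proof.
elim: A S x => // a A IH S x /= nz i.
have [j jS] : exists2 j, j \in S & (a (gstep x j) - a x) * cup A (S :\ j) (gstep x j) != 0.
  apply/exists_inP; rewrite -[X in is_true X]negbK negb_exists_in.
  apply: contra nz => /forall_inP h; apply/eqP; apply: big1 => j jS.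
  by have := h j jS; rewrite negbK => /eqP.
rewrite mulf_eq0 negb_or => /andP[da dA].
have sub k : (x k <= gstep x j k <= x k + (k \in S))%N.
  rewrite ffunE leq_addr leq_add2l; case: (eqVneq k j) => [->|//]; by rewrite jS.
case: i => [_|i] /=.
  exists (gstep x j), x; split=> // [k|]; first by rewrite leqnn leq_addr.
  by rewrite -subr_eq0.
rewrite ltnS => /(IH _ _ dA)[y [z [hy hz e]]]; exists y, z; split=> // k.
  case/andP: (hy k) => y1 y2; case/andP: (sub k) => s1 s2.
  rewrite (leq_trans s1 y1) (leq_trans y2) //.
  by rewrite ffunE !inE; case: (eqVneq k j) => [->|//]; rewrite ?jS /= ?addn0 ?addn1.
case/andP: (hz k) => y1 y2; case/andP: (sub k) => s1 s2.
rewrite (leq_trans s1 y1) (leq_trans y2) //.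
by rewrite ffunE !inE; case: (eqVneq k j) => [->|//]; rewrite ?jS /= ?addn0 ?addn1.
Qed.

Section Box.
Variable N : nat.

Fixpoint boxsum (s : seq 'I_n) (f : {ffun 'I_n -> nat} -> 'F_2) x : 'F_2 :=
  if s is j :: s' then \sum_(t < N) boxsum s' f (gset x j t) else f x.

Lemma boxsum_ext s f g x :
  (forall y, (forall j, j \notin s -> y j = x j) -> f y = g y) ->
  boxsum s f x = boxsum s g x.
Proof.
elim: s x => [|i s IH] x fg /=; first by apply: fg.
apply: eq_bigr => t _; apply: IH => y yx; apply: fg => j.
by rewrite inE negb_or => /andP[ji js]; rewrite yx // ffunE (negbTE ji).
Qed.

Lemma boxsum0 s x : boxsum s (fun=> 0) x = 0.
Proof. by elim: s x => //= i s IH x; rewrite big1. Qed.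

Lemma boxsum_sum s (I : finType) (P : {pred I}) (f : I -> _) x :
  boxsum s (fun y => \sum_(i in P) f i y) x = \sum_(i in P) boxsum s (f i) x.
Proof.
elim: s x => //= i s IH x; rewrite exchange_big /=.
by apply: eq_bigr => t _; rewrite IH.
Qed.

Lemma boxsumB s f g x :
  boxsum s (fun y => f y - g y) x = boxsum s f x - boxsum s g x.
Proof.
elim: s x => //= i s IH x; rewrite -sumrB.
by apply: eq_bigr => t _; rewrite IH.
Qed.

Lemma boxsum_step s j f x : j \notin s ->
  boxsum s (fun y => f (gstep y j)) x = boxsum s f (gstep x j).
Proof.
elim: s x => //= i s IH x; rewrite inE negb_or => /andP[ji js].
by apply: eq_bigr => t _; rewrite IH // gset_stepC // eq_sym.
Qed.

Lemma boxsum_telescope s j f x : uniq s -> j \in s ->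
  boxsum s (fun y => f (gstep y j) - f y) x =
  boxsum (rem j s) f (gset x j N) - boxsum (rem j s) f (gset x j 0).
Proof.
elim: s x => //= i s IH x /andP[is_ us]; rewrite inE eq_sym.
case: (eqVneq i j) is_ => [-> js _|ij is_ /= js].
  under eq_bigr => t _ do rewrite boxsumB boxsum_step // gset_step.
  rewrite -(big_mkord xpredT (fun t => boxsum s f (gset x j t.+1) - boxsum s f (gset x j t))).
  by rewrite telescope_sumr.
rewrite -sumrB; apply: eq_bigr => t _.
by rewrite IH // !(gsetC x _ _ ij).
Qed.

Lemma boxsum_neq0 s f x : boxsum s f x != 0 ->
  exists y, [/\ forall j, j \in s -> (y j < N)%N,
    forall j, j \notin s -> y j = x j & f y != 0].
Proof.
elim: s x => [|i s IH] x /= nz; first by exists x.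
have [t /IH[y [y1 y2 y3]]] : exists t : 'I_N, boxsum s f (gset x i t) != 0.
  apply/existsP; rewrite -[X in is_true X]negbK negb_exists.
  by apply: contra nz => /forallP h; apply/eqP; apply: big1 => t _; have := h t;
     rewrite negbK => /eqP.
exists y; split=> // j; last first.
  by rewrite inE negb_or => /andP[ji js]; rewrite y2 // ffunE (negbTE ji).
case: (boolP (j \in s)) => [/y1//|js].
by rewrite inE (negbTE js) orbF => /eqP ->{j js}; case: (boolP (i \in s)) => [/y1//|/y2 ->];
  rewrite ffunE eqxx.
Qed.

(** Induction on the dimension by Stokes. On the two faces orthogonal to a direction [j] other than
    the head [k], the factor [a j] is constant and the slice vanishes. For [k], the face at 0
    carries the factor 0, and the face at [N] carries the factor 1 and leaves the sum for [s]. *)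
Lemma boxsum_cup (a : 'I_n -> {ffun 'I_n -> nat} -> 'F_2) s x :
  (forall i y, y i = 0%N -> a i y = 0) -> (forall i y, y i = N -> a i y = 1) ->
  uniq s -> (forall j, j \notin s -> x j = N) ->
  boxsum s (cup (map a s) [set j in s]) x = 1.
Proof.
move=> a0 aN; elim: s x => [|k s IH] x // us xN.
rewrite [map _ _]/=.
rewrite (boxsum_ext (g := fun y => \sum_(j in [set j in k :: s])
  (a k (gstep y j) * cup (map a s) ([set j in k :: s] :\ j) (gstep y j)
   - a k y * cup (map a s) ([set j in k :: s] :\ j) y))); last by move=> y _; exact: cup_stokes.
rewrite boxsum_sum (bigD1 k) ?inE ?eqxx //.
have /andP[ks us'] : (k \notin s) && uniq s by [].
have -> : [set j in k :: s] :\ k = [set j in s].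
  by apply/setP=> j; rewrite !inE; case: (eqVneq j k) => [->|]; rewrite ?(negbTE ks).
rewrite [X in X + _ = _](_ : _ = 1) ?[X in _ + X = _]big1 ?addr0 //.
  move=> j; rewrite !inE => /andP[/orP[/eqP->|js] jk]; first by rewrite eqxx in jk.
  rewrite (boxsum_telescope (fun y => a k y * cup (map a s) ([set j0 in k :: s] :\ j) y))
    // ?inE ?js ?orbT //.
  have van t v : (forall y, y j = t -> a j y = v) ->
      boxsum (rem j (k :: s))
        (fun y => a k y * cup (map a s) ([set j0 in k :: s] :\ j) y) (gset x j t) = 0.
    move=> av; rewrite (boxsum_ext (g := fun=> 0)) ?boxsum0 // => y yx.
    rewrite (cup_slice (c := t) (v := v) (k := j)) ?mulr0 ?inE ?eqxx //.
    by rewrite yx ?ffunE ?eqxx // mem_rem_uniqF.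
  by rewrite (van N 1) ?(van 0%N 0) ?subrr // => y; [exact: a0|exact: aN].
rewrite (boxsum_telescope (fun y => a k y * cup (map a s) [set j in s] y)) ?inE ?eqxx //.
rewrite [rem k _]/= eqxx (boxsum_ext (g := cup (map a s) [set j in s])); last first.
  by move=> y yx; rewrite aN ?mul1r // yx // ffunE eqxx.
rewrite IH // => [|j js]; last first.
  by rewrite ffunE; case: eqP => [//|/eqP jk]; rewrite xN // inE negb_or jk js.
rewrite (boxsum_ext (g := fun=> 0)) ?boxsum0 ?subr0 // => y yx.
by rewrite a0 ?mul0r // yx // ffunE eqxx.
Qed.

(** The total over the box is 1 modulo 2, so some cell carries a nonzero product, and a nonzero
    product needs a change of value in every factor. *)
Lemma discrete_miranda (a : 'I_n -> {ffun 'I_n -> nat} -> bool) :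
  (forall i y, y i = 0%N -> ~~ a i y) -> (forall i y, y i = N -> a i y) ->
  exists x : {ffun 'I_n -> nat}, (forall j, (x j < N)%N) /\
    forall i, exists y z : {ffun 'I_n -> nat},
    [/\ forall j, (x j <= y j <= (x j).+1)%N, forall j, (x j <= z j <= (x j).+1)%N,
        a i y & ~~ a i z].
Proof.
move=> a0 aN.
pose A i y : 'F_2 := (a i y)%:R.
have := @boxsum_cup A (enum 'I_n) [ffun=> N].
rewrite /A => /(_ _ _ (enum_uniq _)) h.
have {}h : boxsum (enum 'I_n) (cup (map A (enum 'I_n)) [set j in enum 'I_n]) [ffun=> N] != 0.
  rewrite h ?oner_eq0 // => [i y /a0/negbTE->|i y /aN->|j] //.
  by rewrite mem_enum.
have {h}[x [xN _ /cup_neq0 h]] := boxsum_neq0 h.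
exists x; split=> [j|i]; first by rewrite xN // mem_enum.
have [|y [z [hy hz]]] := h i; first by rewrite size_map size_enum_ord.
rewrite (nth_map i) ?size_enum_ord // nth_ord_enum /A => ne.
have mx (u : {ffun 'I_n -> nat}) : (forall j, x j <= u j <= x j + (j \in [set k in enum 'I_n]))%N ->
    forall j, (x j <= u j <= (x j).+1)%N.
  by move=> hu j; have := hu j; rewrite inE mem_enum addn1.
case ay: (a i y) ne; case az: (a i z) => // _.
  by exists y, z; rewrite ay az; split=> //; exact: mx.
by exists z, y; rewrite ay az; split=> //; exact: mx.
Qed.
End Box.
End CupProduct.

(** * Euclidean geometry of row vectors *)

Section Dot.
Variables (R : realType) (n : nat).
Implicit Types (x y z a : 'rV[R]_n).

Definition dot x y : R := \sum_(i < n) x ord0 i * y ord0 i.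

Lemma dotC x y : dot x y = dot y x.
Proof. by apply: eq_bigr => i _; rewrite mulrC. Qed.
Lemma dotDl x y z : dot (x + y) z = dot x z + dot y z.
Proof. by rewrite -big_split; apply: eq_bigr => i _; rewrite mxE mulrDl. Qed.
Lemma dotZl c x y : dot (c *: x) y = c * dot x y.
Proof. by rewrite mulr_sumr; apply: eq_bigr => i _; rewrite mxE mulrA. Qed.
Lemma dotDr x y z : dot z (x + y) = dot z x + dot z y.
Proof. by rewrite dotC dotDl !(dotC z). Qed.
Lemma dotZr c x y : dot x (c *: y) = c * dot x y.
Proof. by rewrite dotC dotZl dotC. Qed.
Lemma dotNl x y : dot (- x) y = - dot x y.
Proof. by rewrite -scaleN1r dotZl mulN1r. Qed.
Lemma dotNr x y : dot x (- y) = - dot x y.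
Proof. by rewrite dotC dotNl dotC. Qed.
Lemma dotBl x y z : dot (x - y) z = dot x z - dot y z.
Proof. by rewrite dotDl dotNl. Qed.
Lemma dotBr x y z : dot z (x - y) = dot z x - dot z y.
Proof. by rewrite dotDr dotNr. Qed.
Lemma dot0l x : dot 0 x = 0.
Proof. by rewrite -[0](scale0r 0) dotZl mul0r. Qed.
Lemma dot0r x : dot x 0 = 0.
Proof. by rewrite dotC dot0l. Qed.
Lemma dot_sumr (I : Type) (s : seq I) (F : I -> 'rV[R]_n) a :
  dot a (\sum_(i <- s) F i) = \sum_(i <- s) dot a (F i).
Proof.
by elim: s => [|i s IH]; rewrite ?big_nil ?dot0r // !big_cons dotDr IH.
Qed.
Lemma dot_suml (I : Type) (s : seq I) (F : I -> 'rV[R]_n) a :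
  dot (\sum_(i <- s) F i) a = \sum_(i <- s) dot (F i) a.
Proof. by rewrite dotC dot_sumr; apply: eq_bigr => i _; rewrite dotC. Qed.

Lemma dot_ge0 x : 0 <= dot x x.
Proof. by apply: sumr_ge0 => i _; rewrite -expr2 sqr_ge0. Qed.
Lemma dot_eq0 x : (dot x x == 0) = (x == 0).
Proof.
apply/idP/eqP => [|->]; last by rewrite dot0l.
rewrite psumr_eq0 => [/allP h|i _]; last by rewrite -expr2 sqr_ge0.
apply/rowP => i; apply/eqP; rewrite mxE.
by have := h i (mem_index_enum _); rewrite -expr2 expf_eq0.
Qed.
Lemma dot_gt0 x : (0 < dot x x) = (x != 0).
Proof. by rewrite lt_def dot_ge0 andbT dot_eq0. Qed.

Lemma edistE x y : edist x y = Num.sqrt (dot (x - y) (x - y)).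
Proof. by rewrite /edist; congr (Num.sqrt _); apply: eq_bigr => i _; rewrite !mxE expr2. Qed.
Lemma edist_ge0 x y : 0 <= edist x y.
Proof. by rewrite edistE sqrtr_ge0. Qed.
Lemma edist_sqr x y : edist x y ^+ 2 = dot (x - y) (x - y).
Proof. by rewrite edistE sqr_sqrtr // dot_ge0. Qed.
Lemma edistC x y : edist x y = edist y x.
Proof. by rewrite !edistE -opprB dotNl dotNr opprK. Qed.
Lemma edistxx x : edist x x = 0.
Proof. by rewrite edistE subrr dot0l sqrtr0. Qed.
Lemma edist_gt0 x y : (0 < edist x y) = (x != y).
Proof. by rewrite edistE sqrtr_gt0 dot_gt0 subr_eq0. Qed.

Lemma dot_CS x y : dot x y ^+ 2 <= dot x x * dot y y.
Proof.
have := dot_ge0 (dot y y *: x - dot x y *: y).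
rewrite dotBl !dotBr !dotZl !dotZr (dotC y x).
have [->|y0] := eqVneq y 0; first by move=> _; rewrite !dot0r expr0n mulr0.
have := y0; rewrite -dot_gt0 => yy h.
rewrite -subr_ge0 -(pmulr_rge0 _ yy); apply: le_trans h _.
by rewrite le_eqVlt; apply/orP; left; apply/eqP; ring.
Qed.

Lemma edist_triangle x y z : edist x z <= edist x y + edist y z.
Proof.
rewrite -(ler_pXn2r (n := 2)) ?nnegrE ?addr_ge0 ?edist_ge0 //.
rewrite sqrrD !edist_sqr.
have h : dot (x - y) (y - z) <= edist x y * edist y z.
  rewrite !edistE -sqrtrM ?dot_ge0 //.
  by apply: le_trans (ler_norm _) _; rewrite -sqrtr_sqr ler_wsqrtr // dot_CS.
have -> : x - z = (x - y) + (y - z) by rewrite addrA subrK.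
move: (x - y) (y - z) h => u v h; rewrite dotDl !dotDr (dotC v u) mulr2n.
lra.
Qed.

Lemma coord_edist x y i : `|x ord0 i - y ord0 i| <= edist x y.
Proof.
rewrite -sqrtr_sqr ler_wsqrtr // (bigD1 i) //= lerDl.
by apply: sumr_ge0 => j _; rewrite sqr_ge0.
Qed.

Lemma edist_le_sum x y : edist x y <= \sum_(i < n) `|x ord0 i - y ord0 i|.
Proof.
have s0 : 0 <= \sum_(i < n) `|x ord0 i - y ord0 i| by apply: sumr_ge0.
rewrite -(ger0_norm s0) -sqrtr_sqr ler_wsqrtr // expr2 mulr_suml.
apply: ler_sum => i _; rewrite -[X in X <= _]ger0_norm ?sqr_ge0 // normrX expr2 ler_wpM2l //.
by rewrite (bigD1 i) //= lerDl sumr_ge0.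
Qed.

Lemma edist_lt x y d : 0 < d -> (forall i, `|x ord0 i - y ord0 i| < d) ->
  edist x y < d * n.+1%:R.
Proof.
move=> d0 h; apply: le_lt_trans (edist_le_sum _ _) _.
apply: (@le_lt_trans _ _ (\sum_(i < n) d)); first by apply: ler_sum => i _; apply: ltW.
by rewrite sumr_const card_ord -[X in X < _]mulr_natr ltr_pM2l // ltr_nat.
Qed.

Lemma dot_edist a x y : `|dot a x - dot a y| <= (\sum_(i < n) `|a ord0 i|) * edist x y.
Proof.
rewrite -dotBr mulr_suml; apply: le_trans (ler_norm_sum _ _ _) _.
apply: ler_sum => i _; rewrite normrM ler_wpM2l // !mxE; exact: coord_edist.
Qed.

Lemma edistZ c x y : edist (c *: x) (c *: y) = `|c| * edist x y.
Proof.
rewrite !edistE -scalerBr dotZl dotZr mulrA -expr2 sqrtrM ?sqr_ge0 //.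
by rewrite sqrtr_sqr.
Qed.

Lemma edist_addr c x y : edist (x + c) (y + c) = edist x y.
Proof. by rewrite !edistE opprD addrACA subrr addr0. Qed.

Lemma edist0 x y : edist x y = edist (x - y) 0.
Proof. by rewrite !edistE subr0. Qed.

(** Finitely many strict linear inequalities are an open condition; many of the radii below come
    from here. *)
Lemma near_dot (J : eqType) (s : seq J) (a : J -> 'rV[R]_n) (b : J -> R) x :
  (forall j, j \in s -> b j < dot (a j) x) ->
  exists2 d, 0 < d & forall y, edist x y < d -> forall j, j \in s -> b j < dot (a j) y.
Proof.
elim: s => [|j s IH] h; first by exists 1.
have [|d d0 hd] := IH; first by move=> k ks; apply: h; rewrite inE ks orbT.
pose A := \sum_(i < n) `|a j ord0 i| + 1.
have A0 : 0 < A by rewrite ltr_wpDl // sumr_ge0.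
have g0 : 0 < dot (a j) x - b j by rewrite subr_gt0 h // inE eqxx.
exists (Num.min d ((dot (a j) x - b j) / A)).
  by rewrite lt_min d0 divr_gt0.
move=> y; rewrite lt_min => /andP[yd yA] k; rewrite inE => /orP[/eqP ->|]; last exact: hd.
have := dot_edist (a j) x y; rewrite ltr_pdivlMr // in yA.
have := ler_norm (dot (a j) x - dot (a j) y).
have e0 := edist_ge0 x y; rewrite /A mulrDr mulr1 mulrC in yA.
by lra.
Qed.

End Dot.

(** * The Poincare-Miranda theorem *)

Section Miranda.
Variables (R : realType) (n : nat).

Definition cube (r : R) (z : 'rV[R]_n) := forall i, `|z ord0 i| <= r.

Lemma cube_cluster (v : nat -> 'rV[R]_n) (r : R) :
  (forall m, cube r (v m)) ->
  exists2 z : 'rV[R]_n, cube r z &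
    forall (d : R) M, 0 < d -> exists2 m, (M <= m)%N & forall i, `|z ord0 i - v m ord0 i| < d.
Proof.
move=> vr.
have cA := @rV_compact R n (fun=> `[- r, r]%classic) (fun=> @segment_compact _ _ _).
have [|z [zA zc]] := cA (v @ \oo)%classic _ _.
  exists 0%N => // m _ i; rewrite /= in_itv /=.
  by rewrite -ler_norml; exact: vr.
exists z => [i|d M d0].
  by have := zA i; rewrite /= in_itv /= -ler_norml.
have [|_ [[m Mm <-] zm]] := zc [set v m | m in [set m | (M <= m)%N]]%classic (ball z d) _ (nbhsx_ballx _ _ d0).
  by exists M => // m Mm; exists m.
by exists m => // i; exact: zm.2.
Qed.

(** The clamp by [minn] keeps the point in the cube, because the discrete theorem quantifies over
    unbounded indices. *)
Definition gridpoint (r : R) N (x : {ffun 'I_n -> nat}) : 'rV[R]_n :=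
  \row_i (- r + 2 * r * (minn (x i) N)%:R / N%:R).

Lemma gridpoint_cube r N x i : 0 < r -> (0 < N)%N -> `|gridpoint r N x ord0 i| <= r.
Proof.
move=> r0 N0; rewrite mxE ler_norml.
have Nr : 0 < N%:R :> R by rewrite ltr0n.
set q := _ / _; have : 0 <= q by rewrite divr_ge0 ?mulr_ge0 // ltW.
have : q <= 2 * r.
  by rewrite ler_pdivrMr // ler_wpM2l ?ler_nat ?geq_minr // mulr_ge0 // ltW.
by move=> q1 q2; apply/andP; split; lra.
Qed.

Lemma gridpoint_near r N (x y : {ffun 'I_n -> nat}) i : 0 < r -> (0 < N)%N ->
  (x i <= y i <= (x i).+1)%N ->
  `|gridpoint r N x ord0 i - gridpoint r N y ord0 i| <= 2 * r / N%:R.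
Proof.
move=> r0 N0 /andP[xy yx]; rewrite !mxE distrC.
have -> : - r + 2 * r * (minn (y i) N)%:R / N%:R - (- r + 2 * r * (minn (x i) N)%:R / N%:R)
   = 2 * r / N%:R * ((minn (y i) N)%:R - (minn (x i) N)%:R) by ring.
have Nr : 0 < N%:R :> R by rewrite ltr0n.
have rN : 0 <= 2 * r / N%:R by rewrite divr_ge0 ?mulr_ge0 // ltW.
have le : (minn (x i) N <= minn (y i) N)%N by rewrite leq_min geq_minr (leq_trans (geq_minl _ _)).
rewrite normrM ger0_norm // -natrB // normr_nat ler_piMr // -[1]/(1%:R) ler_nat.
rewrite leq_subLR addn1; case: (leqP (x i) N) => xN.
  by rewrite (leq_trans (geq_minl _ _)).
by rewrite (leq_trans (geq_minr _ _)).
Qed.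

(** In ever finer grids some cell sees both signs of every component. By compactness such cells
    accumulate at a point [z]; a nonzero component of [F z] would by continuity keep one sign on a
    late cell. *)
Theorem poincare_miranda (r : R) (F : 'rV[R]_n -> 'rV[R]_n) :
  0 < r ->
  (forall z, cube r z -> forall e, 0 < e -> exists2 d, 0 < d &
     forall z', cube r z' -> edist z z' < d -> edist (F z) (F z') < e) ->
  (forall z i, cube r z -> z ord0 i = - r -> F z ord0 i < 0) ->
  (forall z i, cube r z -> z ord0 i = r -> 0 < F z ord0 i) ->
  exists2 z, cube r z & F z = 0.
Proof.
move=> r0 Fc Fn Fp.
have /choice[x xP] : forall m, exists x : {ffun 'I_n -> nat},
    forall i, exists y z : {ffun 'I_n -> nat},
    [/\ forall j, (x j <= y j <= (x j).+1)%N, forall j, (x j <= z j <= (x j).+1)%N,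
     0 < F (gridpoint r m.+1 y) ord0 i & ~~ (0 < F (gridpoint r m.+1 z) ord0 i)].
  move=> m; have [||x [_ hx]] :=
    @discrete_miranda n m.+1 (fun i x => 0 < F (gridpoint r m.+1 x) ord0 i); last by exists x.
    move=> i y yi; rewrite -leNgt ltW // Fn //; first by move=> j; exact: gridpoint_cube.
    by rewrite mxE yi min0n mulr0 mul0r addr0.
  move=> i y yi; rewrite Fp //; first by move=> j; exact: gridpoint_cube.
  by rewrite mxE yi minnn mulfK ?pnatr_eq0 //; ring.
have [|z zc zP] := @cube_cluster (fun m => gridpoint r m.+1 (x m)) r.
  by move=> m i; exact: gridpoint_cube.
exists z => //; apply/rowP => i; rewrite mxE; apply/eqP/negPn/negP => Fz.
have [|d d0 dP] := Fc z zc `|F z ord0 i|; first by rewrite normr_gt0.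
have n0 : 0 < n.+1%:R :> R by rewrite ltr0n.
have e0 : 0 < d / n.+1%:R / 2 by rewrite !divr_gt0.
(* From [M] on the mesh is below half of [d / n.+1%:R]; the other half is spent on the distance from
   [z] to the base vertex of the cell. *)
have [M _ hM] : exists2 M, True & forall m, (M <= m)%N -> 2 * r / m.+1%:R < d / n.+1%:R / 2.
  exists (Num.bound (2 * r / (d / n.+1%:R / 2))) => // m Mm.
  rewrite ltr_pdivrMr ?ltr0n // [X in _ < X]mulrC -ltr_pdivrMr //.
  apply: (lt_le_trans (archi_boundP _)); last by rewrite ler_nat leqW.
  by apply: divr_ge0; [apply: mulr_ge0 => //; exact: ltW|exact: ltW].
have [m Mm zm] := zP _ M e0.
have close (y : {ffun 'I_n -> nat}) : (forall j, (x m j <= y j <= (x m j).+1)%N) ->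
    `|F z ord0 i - F (gridpoint r m.+1 y) ord0 i| < `|F z ord0 i|.
  move=> hy; apply: le_lt_trans (coord_edist _ _ _) _; apply: dP.
    by move=> j; exact: gridpoint_cube.
  have -> : d = d / n.+1%:R * n.+1%:R by rewrite divfK // gt_eqF.
  apply: edist_lt => [|j]; first by rewrite divr_gt0.
  apply: le_lt_trans (ler_distD (gridpoint r m.+1 (x m) ord0 j) _ _) _.
  have := gridpoint_near r0 (ltn0Sn m) (hy j); have := hM _ Mm; have := zm j.
  move: (2 * r / m.+1%:R) (d / n.+1%:R) => A D; lra.
have [y [w [/close hy /close hw Fy]]] := xP m i.
rewrite -leNgt => Fw.
case: (ltgtP (F z ord0 i) 0) Fz hy hw => // Fz _.
  rewrite (ltr0_norm Fz) => /ltr_normlP[h1 h2] _; lra.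
rewrite (gtr0_norm Fz) => _ /ltr_normlP[h1 h2]; lra.
Qed.
End Miranda.

(** * A free facet is not interior *)

Section FreeFacet.
Variables (R : realType) (n : nat) (V : choiceType) (K : set {fset V}).
Variables (v0 i : V) (tau : {fset V}).
Hypotheses (v0tau : v0 \in tau) (itau : i \notin tau) (Ksigma : K (i |` tau)).
Hypothesis free : forall s, K s -> tau `<=` s -> s `<=` i |` tau.
Let sigma := i |` tau.
Let iv0 : i != v0.
Proof. by apply: contraNneq itau => ->. Qed.

Let isigma : i \in sigma. Proof. by rewrite !inE eqxx. Qed.
Let v0sigma : v0 \in sigma. Proof. by rewrite !inE v0tau orbT. Qed.

Let l1 (x y : V -> R) : R := \sum_(v <- sigma) `|x v - y v|.

Let l1_lip x y y' d : (forall v, `|y v - y' v| < d) ->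
  `|l1 x y - l1 x y'| <= #|` sigma|%:R * d.
Proof.
move=> yy; rewrite -sumrB; apply: le_trans (ler_norm_sum _ _ _) _.
apply: (@le_trans _ _ (\sum_(v <- sigma) d)).
  apply: ler_sum => v _; apply: le_trans (ler_dist_dist _ _) _.
  by rewrite opprB addrC addrA subrK distrC; apply: ltW.
by rewrite big_const_seq count_predT iter_addr_0 mulr_natl.
Qed.

(* Moves [y] into the simplex, away from the free facet [tau]. *)
Let push (t : R) (y : V -> R) v : R := y v + t * ((v == i)%:R - (v == v0)%:R).

Let sum_delta (s : {fset V}) (w : V) (c : R) : w \in s ->
  \sum_(v <- s) c * (v == w)%:R = c.
Proof.
move=> ws; rewrite (big_fsetD1 w) //= eqxx mulr1 big_seq big1 ?addr0 // => v.
by rewrite !inE => /andP[/negbTE -> _]; rewrite mulr0.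
Qed.

Let push_sum t y : \sum_(v <- sigma) push t y v = \sum_(v <- sigma) y v.
Proof.
rewrite /push big_split /= -[RHS]addr0; congr (_ + _).
by under eq_bigr => v _ do rewrite mulrBr; rewrite sumrB !sum_delta // subrr.
Qed.

Let push_dist t y v : 0 <= t -> `|push t y v - y v| <= t.
Proof.
move=> t0; rewrite /push addrC addKr normrM ger0_norm // ler_piMr //.
by case: eqP => [->|_]; rewrite ?(negbTE iv0) ?subr0 ?normr1 // sub0r normrN; case: eqP;
  rewrite ?normr1 ?normr0.
Qed.

(** Near a point [x] interior to the free facet, the realization is just the simplex [sigma].
    Pushing points near [x] off the facet misses [x] and moves nothing farther away; read in the
    chart and translated, this is the map [F]. *)
Lemma free_facet_no_chart : chart_at (n := n) K (vertex_point R v0) setT -> False.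
Proof.
case=> e e0 [f [g /=]]; set B := rball _ _ _; set W := (f @` B)%classic.
case=> [[_ Wo] gf fc gc].
have fg w : W w -> f (g w) = w /\ B (g w) by case=> y By <-; rewrite gf.
pose m := #|` tau|%:R : R.
have m1 : 1 <= m by rewrite ler1n cardfs_gt0; apply/fset0Pn; exists v0.
have m0 : 0 < m by exact: lt_le_trans m1.
have [eta [eta0 me m_1]] : exists eta : R, [/\ 0 < eta, m * eta <= e / 2 & m * eta <= 1].
  exists (Num.min (e / 2) 1 / m); rewrite divr_gt0 ?lt_min ?divr_gt0 //=.
  by rewrite mulrC divfK ?gt_eqF // !ge_min !lexx orbT.
(* All of [tau] gets weight at least [eta], yet [x] stays within [e / 2] of [v0], inside the domain
   of the chart. *)
pose x v : R := (1 - m * eta) * (v == v0)%:R + eta * (v \in tau)%:R.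
have xeta v : v \in tau -> eta <= x v.
  by move=> vt; rewrite /x vt mulr1 lerDr mulr_ge0 // subr_ge0.
have etam : eta <= m * eta by rewrite ler_peMl // ltW.
have xvp v : `|vertex_point R v0 v - x v| <= e / 2.
  apply: le_trans me; rewrite /vertex_point /x; case: eqP => [->|_].
    by rewrite ?eqxx v0tau !mulr1 ger0_norm; lra.
  by case: (v \in tau); rewrite sub0r normrN mulr0 add0r ?mulr1 ?mulr0 ?normr0 ?ger0_norm ?(ltW eta0) //;
    apply: le_trans etam => //; exact: ltW.
pose rho := Num.min eta (e / 2).
have rho0 : 0 < rho by rewrite lt_min eta0 divr_gt0.
have rhoe : rho <= eta by rewrite ge_min lexx.
have rhoe2 : rho <= e / 2 by rewrite ge_min lexx orbT.
have xsum : \sum_(v <- sigma) x v = 1.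
  rewrite big_split /= sum_delta // (big_fsetU1 _ _ itau) /= (negbTE itau) mulr0 add0r.
  rewrite big_seq (eq_bigr (fun=> eta)) => [|v ->]; last by rewrite mulr1.
  by rewrite -big_seq big_const_seq count_predT iter_addr_0 -mulr_natl -/m; ring.
have x0 v : 0 <= x v by rewrite addr_ge0 ?mulr_ge0 ?subr_ge0 ?ler0n // ltW.
have xoff v : v \notin sigma -> x v = 0.
  rewrite !inE negb_or => /andP[vi vt]; rewrite /x (negbTE vt) mulr0 addr0.
  by case: eqP vt => [->|_ _]; rewrite ?v0tau // mulr0.
have real y : (forall v, 0 <= y v) -> (forall v, v \notin sigma -> y v = 0) ->
    \sum_(v <- sigma) y v = 1 -> realization K y.
  by move=> y0 yo y1; split=> //; exists sigma.
have inB y : realization K y -> (forall v, `|x v - y v| < rho) -> B y.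
  move=> Ky xy; split=> // v; apply: le_lt_trans (ler_distD (x v) _ _) _.
  have := xvp v; have := xy v; lra.
(* As [rho <= eta], a point within [rho] of [x] is positive on [tau]; the simplex carrying it
   contains [tau], hence lies in [sigma] by freeness. *)
have supp y : realization K y -> (forall v, `|x v - y v| < rho) ->
    (forall v, v \notin sigma -> y v = 0) /\ \sum_(v <- sigma) y v = 1.
  move=> [y0 [s [Ks [ys s1]]]] xy.
  have ts : tau `<=` s.
    apply/fsubsetP => v vt; apply: contraT => /ys yv.
    by have := xy v; rewrite yv subr0 => /ltr_normlW; have := xeta v vt; lra.
  have ss := free Ks ts; split=> [v vs|]; first by apply: ys; apply: contraNN vs; exact: (fsubsetP ss).
  by rewrite -s1 [RHS](big_fset_incl _ ss) // => v _ /ys.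
have Bx : B x by apply: inB => [|v]; [exact: real|rewrite subrr normr0].
pose z0 := f x.
have Wz0 : W z0 by exists x.
have [dW dW0 WW] := Wo _ Wz0.
have [d2 d20 gd2] := gc z0 Wz0 (rho / 2) (divr_gt0 rho0 (ltr0Sn _ _)).
(* Halving makes the closed cube fit strictly inside the ball; [n.+1%:R] converts coordinatewise
   bounds into [edist]. *)
pose r := Num.min dW d2 / n.+1%:R / 2.
have mm0 : 0 < Num.min dW d2 by rewrite lt_min dW0.
have r0 : 0 < r by rewrite !divr_gt0.
have cubeW z : cube r z -> W (z0 + z) /\ edist z0 (z0 + z) < d2.
  move=> zr; have : edist z0 (z0 + z) < Num.min dW d2.
    have -> : Num.min dW d2 = 2 * r * n.+1%:R by rewrite /r [2 * _]mulrC !divfK ?pnatr_eq0.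
    apply: edist_lt => [|j]; first by rewrite mulr_gt0.
    rewrite mxE opprD addNKr normrN; apply: le_lt_trans (zr j) _.
    by rewrite ltr_pMl // ltr1n.
  by rewrite lt_min => /andP[? ?]; split=> //; apply: WW.
have [d3 d30 fd3] := fc x Bx r r0.
pose del := Num.min (rho / 2) d3.
have del0 : 0 < del by rewrite lt_min d30 divr_gt0.
have delr : del <= rho / 2 by rewrite ge_min lexx.
have deld : del <= d3 by rewrite ge_min lexx orbT.
(* A cut-off: the push has size [del] at [x] and stops at [l1] distance [del]. By the choice of
   [d3], no point on the boundary of the cube is closer than that. *)
pose th y := Num.max 0 (del - l1 x y).
have th0 y : 0 <= th y by rewrite le_max lexx.
have l10 y : 0 <= l1 x y by apply: sumr_ge0.
have thd y : th y <= del by rewrite ge_max (ltW del0) gerBl l10.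
pose P y := push (th y) y.
have PB y : realization K y -> (forall v, `|x v - y v| < rho / 2) -> B (P y).
  move=> Ky xy.
  have [|ys y1] := supp y Ky; first by move=> v; apply: lt_le_trans (xy v) _; lra.
  have Pxy v : `|x v - P y v| < rho.
    apply: le_lt_trans (ler_distD (y v) _ _) _; rewrite (distrC (y v)).
    by have := push_dist y v (th0 y); have := thd y; have := xy v; rewrite /P; lra.
  apply: inB => //; apply: real => [v|v vs|]; last by rewrite push_sum.
    have [vv|vv] := eqVneq v v0.
      have := Pxy v; have := xeta v; rewrite vv v0tau => /(_ isT) h1 /ltr_normlW; lra.
    rewrite /P /push (negbTE vv) subr0 addr_ge0 ?mulr_ge0 ?ler0n //.
    by case: Ky.
  rewrite /P /push ys // add0r; move: vs; case: eqP => [->|_]; first by rewrite isigma.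
  by case: eqP => [->|_]; rewrite ?v0sigma // subrr mulr0.
pose F z := f (P (g (z0 + z))) - z0.
have gnear z : cube r z -> realization K (g (z0 + z)) /\
    forall v, `|x v - g (z0 + z) v| < rho / 2.
  move=> /cubeW[Wz z0z]; split; first by have [_ []] := fg _ Wz.
  by have gx := gd2 _ Wz z0z; move=> v; have := gx v; rewrite /z0 gf.
have bd z j : cube r z -> `|z ord0 j| = r -> F z = z.
  move=> zr zj; have [Wz _] := cubeW z zr; have [Kg xg] := gnear z zr.
  have [fgz Bg] := fg _ Wz.
  have -> : F z = f (g (z0 + z)) - z0; last by rewrite fgz addrC addKr.
  congr (f _ - _); rewrite /P; apply: funext => v; rewrite /push.
  suff -> : th (g (z0 + z)) = 0 by rewrite mul0r addr0.
  apply/max_idPl; rewrite subr_le0 leNgt; apply/negP => lt.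
  have [|gs _] := supp _ Kg; first by move=> w; apply: lt_le_trans (xg w) _; lra.
  have : edist (f x) (f (g (z0 + z))) < r.
    apply: fd3 => // w; have [ws|ws] := boolP (w \in sigma); last first.
      by rewrite xoff // gs // subrr normr0.
    apply: lt_le_trans deld; apply: le_lt_trans lt.
    rewrite /l1 (big_fsetD1 w) //= lerDl; exact: sumr_ge0.
  rewrite fgz -/z0 => lt2; have := coord_edist z0 (z0 + z) j.
  by rewrite mxE opprD addNKr normrN zj leNgt lt2.
have [|z j zr zj|z j zr zj|z zr Fz] := @poincare_miranda R n r F r0.
- move=> z zr eps eps0.
  have [Wz _] := cubeW z zr; have [Kg xg] := gnear z zr.
  have [d4 d40 fd4] := fc _ (PB _ Kg xg) eps eps0.
  pose c := #|` sigma|%:R + 1 : R.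
  have c0 : 0 < c by rewrite ltr_wpDl.
  have [d5 d50 gd5] := gc _ Wz (d4 / c) (divr_gt0 d40 c0).
  exists d5 => // z' zr' zz'; have [Wz' _] := cubeW z' zr'; have [Kg' xg'] := gnear z' zr'.
  rewrite edist_addr; apply: fd4; first exact: PB.
  have gg : forall v, `|g (z0 + z) v - g (z0 + z') v| < d4 / c.
    by apply: gd5 => //; rewrite ![z0 + _]addrC edist_addr.
  move: (g (z0 + z)) (g (z0 + z')) gg => y y' yy v.
  have h1 := l1_lip x yy.
  have h2 : `|th y - th y'| <= #|` sigma|%:R * (d4 / c).
    apply: le_trans h1; rewrite /th.
    move: (l1 x y) (l1 x y') => a b; rewrite !maxEle.
    have := ler_norm (a - b); have := ler_norm (b - a); rewrite (distrC b a) => h5 h6.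
    by rewrite ler_norml; case: (lerP 0 (del - a)) => h3; case: (lerP 0 (del - b)) => h4;
      apply/andP; split; lra.
  have -> : P y v - P y' v = (y v - y' v) + (th y - th y') * ((v == i)%:R - (v == v0)%:R).
    by rewrite /P /push; ring.
  apply: le_lt_trans (ler_normD _ _) _.
  have -> : d4 = d4 / c + #|` sigma|%:R * (d4 / c) by rewrite /c; field; rewrite -/c gt_eqF.
  apply: ltr_leD; first exact: yy.
  apply: le_trans h2; rewrite normrM ler_piMr //.
  by case: eqP => [->|_]; rewrite ?(negbTE iv0) ?subr0 ?normr1 // sub0r normrN; case: eqP;
    rewrite ?normr1 ?normr0.
- by rewrite (bd z j) // zj ?normrN ?gtr0_norm // oppr_lt0.
- by rewrite (bd z j) // zj ?gtr0_norm.
(* A zero of [F] gives [P y = x]. Since [x] vanishes at [i], no push took place, so [y = x]; but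
   there the push has size [del > 0]. *)
have [Wz _] := cubeW z zr; have [Kg xg] := gnear z zr.
have BP := PB _ Kg xg; set y := g (z0 + z) in Kg xg BP.
have Px : P y = x.
  by rewrite -(gf _ BP) -(gf _ Bx); congr g; apply/eqP; rewrite -subr_eq0; apply/eqP.
have y0 v : 0 <= y v by case: Kg.
have thy : th y = 0.
  have := congr1 (fun h => h i) Px; rewrite /P /push eqxx (negbTE iv0) subr0 mulr1.
  rewrite /x (negbTE iv0) (negbTE itau) !mulr0 addr0.
  by have := th0 y; have := y0 i; lra.
have yx : y = x by rewrite -Px /P; apply: funext => v; rewrite /push thy mul0r addr0.
move: thy; rewrite /th yx /l1 big1 => [|v _]; last by rewrite subrr normr0.
by rewrite subr0 => /max_idPl; rewrite leNgt del0.
Qed.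

End FreeFacet.

(** * Simplicial fans *)

Lemma seq_min (R : realType) (A : eqType) (f : A -> R) (s : seq A) :
  s != [::] -> exists2 a, a \in s & forall b, b \in s -> f a <= f b.
Proof.
elim: s => // a s IH _; have [->|/IH[b bs hb]] := eqVneq s [::].
  by exists a; rewrite ?mem_head // => b; rewrite inE => /eqP ->.
case: (lerP (f a) (f b)) => ab.
  exists a; rewrite ?mem_head // => c; rewrite inE => /orP[/eqP->//|/hb]; exact: le_trans.
exists b; first by rewrite inE bs orbT.
by move=> c; rewrite inE => /orP[/eqP->|/hb//]; exact: ltW.
Qed.

(** Each [t] carries at most one value, so the largest of finitely many values has no successor. *)
Lemma no_ascent (R : realType) (A : eqType) (T : seq A) (Q : A -> R -> Prop) :
  (forall t r, Q t r -> t \in T) -> (forall t r r', Q t r -> Q t r' -> r <= r') ->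
  (forall t r, Q t r -> exists t' r', Q t' r' /\ r < r') -> forall t r, ~ Q t r.
Proof.
move=> QT Qu Qs t r Qtr.
pose b t := xget 0 [set r | Q t r]%classic.
have bE u c : Q u c -> Q u (b u) by move=> h; apply: (xgetI 0 h).
pose T' := [seq t <- T | `[< Q t (b t) >]].
have [|u] := @seq_min R A (fun t => - b t) T'.
  by apply/eqP => T0; have : t \in T' by [rewrite mem_filter (QT _ _ Qtr) andbT; apply/asboolP/bE/Qtr];
    rewrite T0.
rewrite mem_filter => /andP[/asboolP Qu' _] um.
have [v [c [Qv bc]]] := Qs _ _ Qu'.
have := um v; rewrite mem_filter (QT _ _ Qv) andbT lerN2 => h.
have /h : `[< Q v (b v) >] by apply/asboolP/bE/Qv.
by have := Qu _ _ _ Qv (bE _ _ Qv); lra.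
Qed.

Section Fan.
Variables (R : realType) (n : nat) (I : choiceType).
Implicit Types (q : I -> 'rV[R]_n) (s t : {fset I}) (a b c : I -> R) (x y : 'rV[R]_n)
  (T : seq {fset I}).

Lemma near_dir x v (d : R) : 0 < d ->
  exists2 e : R, 0 < e & forall t : R, 0 <= t -> t <= e -> edist x (x + t *: v) < d.
Proof.
move=> d0; exists (d / (edist v 0 + 1)).
  by rewrite divr_gt0 // ltr_wpDl // edist_ge0.
move=> t t0; rewrite ler_pdivlMr ?ltr_wpDl ?edist_ge0 //.
have -> : edist x (x + t *: v) = t * edist v 0.
  by rewrite edistC edist0 addrAC subrr add0r -[X in edist _ X](scaler0 _ t) edistZ ger0_norm.
rewrite mulrDr mulr1.
have [->|] := eqVneq t 0; first by rewrite !mul0r.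
move=> tn; have : 0 < t by rewrite lt_def tn.
by lra.
Qed.

(** If the new form [m] vanishes at the point found so far, a small move along [m] itself makes it
    nonzero, and the earlier conditions are open. *)
Lemma generic_point (P M : seq 'rV[R]_n) y0 :
  (forall p, p \in P -> 0 < dot p y0) -> (forall m, m \in M -> m != 0) ->
  exists2 y, forall p, p \in P -> 0 < dot p y & forall m, m \in M -> dot m y != 0.
Proof.
move=> P0; elim: M => [|m M IH] M0; first by exists y0.
have [|y yP yM] := IH; first by move=> k kM; apply: M0; rewrite inE kM orbT.
have m0 : m != 0 by apply: M0; rewrite mem_head.
have [d1 d10 h1] := @near_dot R n _ P id (fun=> 0) y yP.
(* Scaling [k] by its own value at [y] turns nonvanishing into a strict inequality. *)
have [|d2 d20 h2] := @near_dot R n _ M (fun k => dot k y *: k) (fun=> 0) y.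
  by move=> k kM; rewrite dotZl -expr2 lt_def sqr_ge0 sqrf_eq0 yM.
have near z : edist y z < Num.min d1 d2 ->
    (forall p, p \in P -> 0 < dot p z) /\ (forall k, k \in M -> dot k z != 0).
  rewrite lt_min => /andP[/h1 z1 /h2 z2]; split=> // k kM.
  by have := z2 k kM; rewrite dotZl; apply: contraTneq => ->; rewrite mulr0 ltxx.
have d0 : 0 < Num.min d1 d2 by rewrite lt_min d10.
have [my|my] := eqVneq (dot m y) 0; last first.
  exists y => // k; rewrite inE => /orP[/eqP->//|]; exact: yM.
have [e e0 he] := near_dir y m d0.
have [z1 z2] := near _ (he e (ltW e0) (lexx _)).
exists (y + e *: m) => // k; rewrite inE => /orP[/eqP->|]; last exact: z2.
by rewrite dotDr my add0r dotZr mulf_neq0 ?gt_eqF // dot_gt0.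
Qed.

Definition coef s a := (forall i, 0 <= a i) /\ (forall i, i \notin s -> a i = 0).
Definition comb q s a : 'rV[R]_n := \sum_(i <- s) a i *: q i.
(** Coefficients are total functions vanishing off their simplex, so this single condition says both
    that each cone is simplicial and that two cones meet only in the cone over their common face. *)
Definition fan q T := forall s t a b, s \in T -> t \in T -> coef s a -> coef t b ->
  comb q s a = comb q t b -> forall i, a i = b i.

Lemma comb_widen q s t a : s `<=` t -> (forall i, i \notin s -> a i = 0) ->
  comb q s a = comb q t a.
Proof.
by move=> st a0; apply: big_fset_incl => // i _ /a0 ->; rewrite scale0r.
Qed.

Lemma sum_widen s t a : s `<=` t -> (forall i, i \notin s -> a i = 0) ->
  \sum_(i <- s) a i = \sum_(i <- t) a i.
Proof. by move=> st a0; apply: big_fset_incl => // i _ /a0 ->. Qed.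

Lemma combD q s a b : comb q s (fun i => a i + b i) = comb q s a + comb q s b.
Proof. by rewrite -big_split; apply: eq_bigr => i _; rewrite scalerDl. Qed.

Lemma combZ q s r a : comb q s (fun i => r * a i) = r *: comb q s a.
Proof. by rewrite scaler_sumr; apply: eq_bigr => i _; rewrite scalerA. Qed.

Lemma eq_comb q s a b : (forall i, i \in s -> a i = b i) -> comb q s a = comb q s b.
Proof. by move=> ab; rewrite /comb !big_seq; apply: eq_bigr => i /ab ->. Qed.

Lemma dot_comb q s a x : dot x (comb q s a) = \sum_(i <- s) a i * dot x (q i).
Proof. by rewrite dot_sumr; apply: eq_bigr => i _; rewrite dotZr. Qed.

Definition delta (i : I) : I -> R := fun k => (k == i)%:R.

Lemma coef_delta s i : i \in s -> coef s (delta i).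
Proof.
move=> is_; split=> [k|k ks]; rewrite /delta; first exact: ler0n.
by case: eqP ks => [->|//]; rewrite is_.
Qed.

Lemma sum_delta s i (F : I -> R) : i \in s -> \sum_(k <- s) F k * delta i k = F i.
Proof.
move=> is_; rewrite (big_fsetD1 i) //= /delta eqxx mulr1 big_seq big1 ?addr0 // => k.
by rewrite !inE => /andP[/negbTE -> _]; rewrite mulr0.
Qed.

Lemma comb_delta q s i : i \in s -> comb q s (delta i) = q i.
Proof.
move=> is_; rewrite /comb (big_fsetD1 i) //= /delta eqxx scale1r big_seq big1 ?addr0 // => k.
by rewrite !inE => /andP[/negbTE -> _]; rewrite scale0r.
Qed.

Definition restr s a : I -> R := fun i => if i \in s then a i else 0.

Lemma coef_restr s a : (forall i, i \in s -> 0 <= a i) -> coef s (restr s a).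
Proof.
by move=> a0; split=> i; rewrite /restr; [case: ifP => // /a0|case: ifP].
Qed.

Lemma comb_restr q s a : comb q s (restr s a) = comb q s a.
Proof. by apply: eq_comb => i; rewrite /restr => ->. Qed.

Lemma sum_restr s a : \sum_(i <- s) restr s a i = \sum_(i <- s) a i.
Proof. by rewrite !big_seq; apply: eq_bigr => i; rewrite /restr => ->. Qed.

Lemma coefD s a b : coef s a -> coef s b -> coef s (fun i => a i + b i).
Proof.
move=> [a0 as_] [b0 bs]; split=> i; first by rewrite addr_ge0.
by move=> is_; rewrite as_ // bs // addr0.
Qed.

Lemma coefZ s r a : 0 <= r -> coef s a -> coef s (fun i => r * a i).
Proof.
move=> r0 [a0 as_]; split=> i; first by rewrite mulr_ge0.
by move=> is_; rewrite as_ // mulr0.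
Qed.

Lemma coefS s t a : s `<=` t -> coef s a -> coef t a.
Proof.
move=> st [a0 as_]; split=> // i it; apply: as_; apply: contraNN it; exact: (fsubsetP st).
Qed.

Definition free q s := forall c, comb q s c = 0 -> forall i, i \in s -> c i = 0.

(** The positive and negative parts of a relation are two nonnegative representations of one
    point. *)
Lemma fan_free q T s : fan q T -> s \in T -> free q s.
Proof.
move=> fT sT c c0 i is_.
pose p := restr s (fun i => Num.max (c i) 0); pose m := restr s (fun i => Num.max (- c i) 0).
have mx (r : R) : Num.max r 0 = r + Num.max (- r) 0 by case: (lerP r 0) => h; case: (lerP (- r) 0) => h'; lra.
have : p i = m i.
  apply: (fT s s); rewrite ?sT //; first by apply: coef_restr => k _; rewrite le_max lexx orbT.
    by apply: coef_restr => k _; rewrite le_max lexx orbT.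
  rewrite !comb_restr -[RHS]add0r -c0 -combD; apply: eq_comb => k _; exact: mx.
rewrite /p /m /restr is_ mx; lra.
Qed.

(** The dual basis: [lam i] reads off the [i]-th coordinate, hence is the inner normal of the wall
    opposite [i]. *)
Definition dual q s (lam : I -> 'rV[R]_n) :=
  (forall x, x = comb q s (fun i => dot (lam i) x)) /\
  (forall i j, i \in s -> j \in s -> dot (lam i) (q j) = (i == j)%:R).

Lemma dual_exists q s : #|` s| = n -> free q s -> exists lam, dual q s lam.
Proof.
move=> sn fs.
have szs : size s == n by rewrite -sn.
pose e := tnth (Tuple szs).
have se F : \sum_(i <- s) F i = \sum_k F (e k) :> 'rV[R]_n by exact: (big_tuple _ _ (Tuple szs)).
have es k : e k \in s by exact: (mem_tnth k (Tuple szs)).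
have ue : injective e by apply/tuple_uniqP; exact: fset_uniq.
have es' i : i \in s -> exists k, e k = i.
  by move=> /(tnthP (Tuple szs))[k ->]; exists k.
pose M : 'M[R]_n := \matrix_k q (e k).
(* The sum has one term for [i] in [s] and none otherwise, which avoids choosing an inverse of
   [e]. *)
pose co (v : 'rV[R]_n) (i : I) := \sum_(k | e k == i) v ord0 k.
have coE v k : co v (e k) = v ord0 k.
  by rewrite /co (big_pred1 k) // => l; rewrite (inj_eq ue).
have vM v : v *m M = comb q s (co v).
  rewrite mulmx_sum_row /comb se; apply: eq_bigr => k _; by rewrite rowK coE.
have uM : M \in unitmx.
  rewrite -row_free_unit; apply: inj_row_free => v vM0; apply/rowP => k; rewrite mxE -coE.
  by apply: (fs (co v)) => //; rewrite -vM.
exists (fun i => \sum_(k | e k == i) (col k (invmx M))^T).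
have lamE i x : dot (\sum_(k | e k == i) (col k (invmx M))^T) x = co (x *m invmx M) i.
  rewrite -big_filter dot_suml big_filter; apply: eq_bigr => k _.
  by rewrite mxE; apply: eq_bigr => l _; rewrite !mxE mulrC.
have xE x : x = comb q s (co (x *m invmx M)) by rewrite -vM mulmxKV.
split=> [x|i j is_ js].
  by rewrite [LHS]xE; apply: eq_comb => i _; rewrite lamE.
rewrite lamE; apply/eqP; rewrite -subr_eq0; apply/eqP.
apply: (fs (fun i => co (q j *m invmx M) i - (i == j)%:R)) => //.
rewrite (@eq_comb _ _ _ (fun i => co (q j *m invmx M) i + (-1) * delta j i)); last by move=> k _; rewrite mulN1r.
by rewrite combD combZ comb_delta // -xE scaleN1r subrr.
Qed.

Lemma dual_comb q s lam c i : dual q s lam -> i \in s ->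
  dot (lam i) (comb q s c) = c i.
Proof.
move=> [_ d] is_; rewrite dot_comb -[RHS](sum_delta _ is_) !big_seq.
by apply: eq_bigr => k ks; rewrite d // /delta eq_sym.
Qed.

End Fan.

(** * Walking through a fan *)

Section Walk.
Variables (R : realType) (n : nat) (I : choiceType).
Variables (q : I -> 'rV[R]_n) (T : seq {fset I}) (lam : {fset I} -> I -> 'rV[R]_n).
Implicit Types (s t : {fset I}) (x y : 'rV[R]_n).

(** The cone [t] is the neighbour of [s] across the wall opposite [i]; the sign puts the new
    generator strictly beyond that wall, so the fan does not fold back. *)
Definition opposite s i t j :=
  [/\ t \in T, j \notin s, t = j |` (s `\ i) & dot (lam s i) (q j) < 0].

Definition walls_shared := forall s i, s \in T -> i \in s -> exists t j, opposite s i t j.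

Definition in_cone t x := forall k, k \in t -> 0 <= dot (lam t k) x.

Hypothesis dualT : forall s, s \in T -> dual q s (lam s).
Hypothesis wallsT : walls_shared.

Lemma lam_neq0 s i : s \in T -> i \in s -> lam s i != 0.
Proof.
move=> sT is_; have [_ d] := dualT sT; apply/eqP => l0.
by have := d i i is_ is_; rewrite l0 dot0l eqxx => /eqP; rewrite eq_sym oner_eq0.
Qed.

(** This form vanishes at [x] and wherever the two wall functionals vanish together. If it is
    nonzero at [y], no point of the segment from [y] to [x], except possibly [x], lies on both
    walls. *)
Definition pencil x s i j := dot (lam s j) x *: lam s i - dot (lam s i) x *: lam s j.

Lemma pencil_eq0 x s i j : s \in T -> i \in s -> j \in s -> i != j ->
  pencil x s i j = 0 -> dot (lam s i) x = 0 /\ dot (lam s j) x = 0.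
Proof.
move=> sT is_ js ij p0; have [_ d] := dualT sT.
have := congr1 (fun v => dot v (q i)) p0; have := congr1 (fun v => dot v (q j)) p0.
rewrite /pencil !dotBl !dotZl !dot0l !d // !eqxx (negbTE ij) eq_sym (negbTE ij).
by rewrite !mulr0 !mulr1 subr0 sub0r => /eqP; rewrite oppr_eq0 => /eqP.
Qed.

(** Both functionals vanish on the shared wall, so [lam t j] is a multiple of [lam s i]; evaluation
    at [q j] shows that the factor is negative. *)
Lemma opposite_dual s i t j x : s \in T -> i \in s -> opposite s i t j ->
  dot (lam s i) x < 0 -> 0 < dot (lam t j) x.
Proof.
move=> sT is_ [tT js tE neg] xneg.
have [xE _] := dualT sT; have [_ dt] := dualT tT.
have jt : j \in t by rewrite tE !inE eqxx.
have key z : dot (lam t j) z = dot (lam s i) z * dot (lam t j) (q i).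
  rewrite [in LHS](xE z) dot_comb (big_fsetD1 i) //= big_seq big1 ?addr0 // => k ks.
  have kt : k \in t by rewrite tE inE ks orbT.
  rewrite dt // (_ : (j == k) = false) ?mulr0 //.
  by apply: contraNF js => /eqP ->; move: ks; rewrite !inE => /andP[].
have h := key (q j); rewrite dt // eqxx in h.
rewrite key nmulr_rgt0 //.
by rewrite -(nmulr_rgt0 _ neg) -h ltr01.
Qed.

Lemma opposite_wall s i t j z k : s \in T -> i \in s -> opposite s i t j ->
  dot (lam s i) z = 0 -> k \in t -> dot (lam t k) z = if k == j then 0 else dot (lam s k) z.
Proof.
move=> sT is_ [tT js tE neg] z0 kt.
have [zE _] := dualT sT.
have zw : z = comb q t (restr (s `\ i) (fun k => dot (lam s k) z)).
  rewrite [LHS]zE /comb (big_fsetD1 i) //= z0 scale0r add0r.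
  rewrite -[LHS](comb_restr q (s `\ i)); apply: comb_widen => [|k' /negbTE h]; last by rewrite /restr h.
  by rewrite tE fsubsetUr.
rewrite [in LHS]zw (dual_comb _ (dualT tT) kt) /restr; case: eqP kt => [->|kj].
  by rewrite !inE (negbTE js) andbF.
by rewrite tE !inE => /orP[/eqP //|->].
Qed.

Section Segment.
Variables (x y : 'rV[R]_n).
Let z (r : R) := y + r *: (x - y).

Let dotz v r : dot v (z r) = (1 - r) * dot v y + r * dot v x.
Proof. by rewrite /z dotDr dotZr dotBr; ring. Qed.

Hypothesis generic : forall t i j, t \in T -> i \in t -> j \in t -> i != j ->
  forall r, 0 <= r -> r < 1 -> dot (lam t i) (z r) = 0 -> dot (lam t j) (z r) <> 0.

Let exits t r := [/\ t \in T, 0 <= r < 1, in_cone t (z r) &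
  exists i, [/\ i \in t, dot (lam t i) (z r) = 0 & dot (lam t i) x < 0]].

(** Each functional that is negative at [x] vanishes once along the segment, at [b k]; the exit is
    the smallest of these times. It is strictly later than [r] when none of these walls contains the
    entry point. *)
Let exit_exists t r : t \in T -> 0 <= r < 1 -> in_cone t (z r) -> ~ in_cone t x ->
  exists r', [/\ exits t r', r <= r' &
    (forall k, k \in t -> dot (lam t k) x < 0 -> 0 < dot (lam t k) (z r)) -> r < r'].
Proof.
move=> tT /andP[r0 r1] zr xt.
pose N := [seq k <- enum_fset t | dot (lam t k) x < 0].
have Nn : N != [::].
  apply/eqP => N0; apply: xt => k kt; rewrite leNgt; apply/negP => xk.
  by have : k \in N by [rewrite mem_filter xk]; rewrite N0.
pose b k := dot (lam t k) y / (dot (lam t k) y - dot (lam t k) x).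
have [i] := seq_min b Nn; rewrite mem_filter => /andP[xi it] imin.
have hy k : k \in t -> dot (lam t k) x < 0 -> 0 <= dot (lam t k) y.
  move=> kt xk; have := zr k kt; rewrite dotz => h.
  have h2 : 0 <= (1 - r) * dot (lam t k) y.
    have : r * dot (lam t k) x <= 0 by rewrite mulr_ge0_le0 // ltW.
    lra.
  by move: h2; rewrite pmulr_rge0 // subr_gt0.
have yi := hy i it xi.
have den k : k \in t -> dot (lam t k) x < 0 -> 0 < dot (lam t k) y - dot (lam t k) x.
  by move=> kt xk; have := hy k kt xk; lra.
have zb k c : k \in t -> dot (lam t k) x < 0 ->
    dot (lam t k) (z c) = (b k - c) * (dot (lam t k) y - dot (lam t k) x).
  by move=> kt xk; rewrite dotz /b [RHS]mulrBl divfK ?gt_eqF ?den //; ring.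
have rb k : k \in t -> dot (lam t k) x < 0 -> r <= b k.
  move=> kt xk; have := zr k kt; rewrite (zb k) // pmulr_lge0 ?den //; lra.
have bi1 : b i < 1 by rewrite /b ltr_pdivrMr ?den //; lra.
exists (b i); split; last 2 first.
- exact: rb.
- move=> /(_ i it xi); rewrite (zb i) // pmulr_lgt0 ?den //; lra.
split=> //; last 2 first.
- move=> k kt; have [xk|xk] := ltP (dot (lam t k) x) 0.
    rewrite (zb k) // mulr_ge0 ?(ltW (den _ _ _)) // subr_ge0; apply: imin.
    by rewrite mem_filter xk.
  have h : (1 - r) * dot (lam t k) (z (b i)) =
      (1 - b i) * dot (lam t k) (z r) + (b i - r) * dot (lam t k) x by rewrite !dotz; ring.
  rewrite -(pmulr_rge0 _ (_ : 0 < 1 - r)) ?subr_gt0 // h.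
  by rewrite addr_ge0 // mulr_ge0 ?zr // subr_ge0 ?rb // ltW.
- by exists i; split=> //; rewrite (zb i) // subrr mul0r.
by rewrite bi1 (le_trans r0 (rb i it xi)).
Qed.

(* Leaving a good cone through a wall leads to a good cone with a strictly later
   exit time, which finitely many cones do not allow. *)
Lemma walk_generic (good : {fset I} -> Prop) s0 :
  s0 \in T -> good s0 -> in_cone s0 y ->
  (forall s i t j, s \in T -> good s -> i \in s -> opposite s i t j ->
     dot (lam s i) x < 0 -> good t) ->
  exists t, [/\ t \in T, good t & in_cone t x].
Proof.
move=> s0T g0 ys0 gstep; apply: contrapT => no.
have out t : t \in T -> good t -> ~ in_cone t x by move=> tT gt xt; apply: no; exists t.
have [||r [e0 _ _]] := @exit_exists s0 0 s0T _ _ (out _ s0T g0).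
- by rewrite lexx ltr01.
- by rewrite /z scale0r addr0.
apply: (@no_ascent R _ T (fun t r => exits t r /\ good t) _ _ _ s0 r) => //.
- by move=> t r' [[]].
(* Exit times are unique: after the exit, the functional of the exit wall is negative, so the point
   is no longer in the cone. *)
- move=> t r1 r2 [[_ /andP[_ r11] z1 _] _] [[_ /andP[_ r21] _ [i [it zi xi]]] _].
  have h1 := z1 i it; rewrite leNgt; apply/negP => r12.
  have h : (1 - r2) * dot (lam t i) (z r1) =
     (1 - r1) * dot (lam t i) (z r2) + (r1 - r2) * dot (lam t i) x by rewrite !dotz; ring.
  have : 0 <= (1 - r2) * dot (lam t i) (z r1) by rewrite mulr_ge0 // subr_ge0 ltW.
  by rewrite h zi mulr0 add0r leNgt pmulr_rlt0 ?subr_gt0 // xi.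
move=> t r' [[tT r1 zr [i [it zi xi]]] gt].
have [u [j opp]] := wallsT tT it.
have gu := gstep _ _ _ _ tT gt it opp xi.
have [uT jt uE _] := opp.
have zu k := opposite_wall (k := k) tT it opp zi.
have uk k : k \in u -> k != j -> k \in t /\ k != i.
  by rewrite uE !inE => /orP[/eqP ->|/andP[-> ->] //]; rewrite eqxx.
have [|r2 [e2 _ lt]] := @exit_exists u r' uT r1 _ (out _ uT gu).
- move=> k ku; rewrite zu //; case: eqP => // /eqP kj.
  by apply: zr; case: (uk _ ku kj).
- exists u, r2; split=> //; apply: lt => k ku xk.
have kj : k != j.
  by apply: contraTneq xk => ->; rewrite -leNgt ltW // (opposite_dual tT it opp).
have [kt ki] := uk _ ku kj.
(* If the new cone had a further such wall through the crossing point, two functionals of [t] would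
   vanish there at once, against [generic]. *)
rewrite zu // (negbTE kj) lt_def zr // andbT; apply/eqP => zk.
case/andP: r1 => r10 r11.
by apply: (generic tT it kt _ r10 r11 zi zk); rewrite eq_sym.
Qed.

End Segment.

(** The start [y] is chosen inside the first cone, off all walls and all nonzero pencils, so that
    the segment to [x] crosses one wall at a time. *)
Lemma walk x (good : {fset I} -> Prop) s0 :
  s0 \in T -> good s0 ->
  (forall s i t j, s \in T -> good s -> i \in s -> opposite s i t j ->
     dot (lam s i) x < 0 -> good t) ->
  exists t, [/\ t \in T, good t & in_cone t x].
Proof.
move=> s0T g0 gstep.
pose P := [seq lam s0 i | i <- enum_fset s0].
pose M := [seq m <- [seq lam t i | t <- T, i <- enum_fset t] ++
  flatten [seq [seq pencil x t i j | i <- enum_fset t, j <- enum_fset t] | t <- T] | m != 0].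
have [||y yP yM] := @generic_point R n P M (comb q s0 (fun=> 1)).
- move=> _ /mapP[i is0 ->]; by rewrite (dual_comb _ (dualT s0T) is0) ltr01.
- by move=> m; rewrite mem_filter => /andP[].
apply: (@walk_generic x y _ good s0) => //; last first.
  by move=> k ks0; apply/ltW/yP/map_f.
move=> t i j tT it jt ij r r0 r1; rewrite !dotDr !dotZr !dotBr => zi zj.
have li : dot (lam t i) y != 0.
  apply: yM; rewrite mem_filter (lam_neq0 tT it) mem_cat; apply/orP; left.
  by apply/allpairsPdep; exists t, i.
(* A zero pencil means that both functionals vanish at [x]; then neither vanishes earlier on the
   segment, as they do not vanish at [y]. *)
have [p0|p0] := eqVneq (pencil x t i j) 0.
  have [xi xj] := pencil_eq0 tT it jt ij p0.
  move/eqP: zi; rewrite xi sub0r mulrN -mulNr -[X in X + _]mul1r -mulrDl mulf_eq0 (negbTE li) orbF.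
  by rewrite gt_eqF // subr_gt0.
have : dot (pencil x t i j) y != 0.
  apply: yM; rewrite mem_filter p0 mem_cat; apply/orP; right.
  apply/flatten_mapP; exists t => //; apply/allpairsPdep; by exists i, j.
apply/negP; rewrite negbK /pencil dotBl !dotZl.
have : (1 - r) * (dot (lam t j) x * dot (lam t i) y - dot (lam t i) x * dot (lam t j) y) = 0.
  transitivity (dot (lam t j) x * (dot (lam t i) y + r * (dot (lam t i) x - dot (lam t i) y))
    - dot (lam t i) x * (dot (lam t j) y + r * (dot (lam t j) x - dot (lam t j) y))); first by ring.
  by rewrite zi zj !mulr0 subrr.
by move/eqP; rewrite mulf_eq0 gt_eqF ?subr_gt0.
Qed.

End Walk.

(** Otherwise each [t] fails below some threshold, and the least of the finitely many thresholds
    gives a contradiction. *)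
Lemma pigeonhole_small (R : realType) (A : eqType) (T : seq A) (P : A -> R -> Prop) :
  (forall e, 0 < e -> exists2 t, t \in T & P t e) ->
  exists2 t, t \in T & forall e, 0 < e -> exists e', [/\ 0 < e', e' <= e & P t e'].
Proof.
move=> PT; apply: contrapT => no.
have /choice[f fP] : forall t, exists e : R, 0 < e /\
    (t \in T -> forall e', 0 < e' -> e' <= e -> ~ P t e').
  move=> t; apply: contrapT => h; apply: no.
  have tT : t \in T by apply: contrapT => nt; apply: h; exists 1; split=> // tT; case: nt.
  exists t => // e e0; apply: contrapT => h2; apply: h; exists e; split=> // _ e' e'0 e'e Pe.
  by apply: h2; exists e'.
have [|t tT tmin] := @seq_min R A f T.
  by apply/eqP => T0; have [t] := PT 1 ltr01; rewrite T0.
have [u uT Pu] := PT (f t) (fP t).1.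
exact: (fP u).2 uT _ (fP t).1 (tmin _ uT) Pu.
Qed.

Lemma fset_exchange (I : choiceType) (s t : {fset I}) i :
  i \in s -> #|` s| = #|` t| -> s `\ i `<=` t -> t != s ->
  exists2 j, j \notin s & t = j |` (s `\ i).
Proof.
move=> is_ st sub ts.
have /cardfs1P[j tj] : #|` t `\` (s `\ i)| == 1%N.
  rewrite cardfsDS //; move: st; rewrite (cardfsD1 i s) is_ => <-.
  by rewrite addnK.
have tE : t = j |` (s `\ i).
  by rewrite -tj fsetUC -[LHS](fsetID (s `\ i)) (fsetIidPr sub).
exists j => //; apply: contraNN ts => js.
have ji : j = i.
  apply/eqP; apply: contraT => ji.
  have : j \in t `\` (s `\ i) by rewrite tj inE.
  by rewrite !inE js ji.
by rewrite tE ji fsetD1K.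
Qed.

(** * Neighbours across walls, in complete fans and in fans without free ridges *)

Section Walls.
Variables (R : realType) (n : nat) (I : choiceType).
Variables (q : I -> 'rV[R]_n) (T : seq {fset I}) (lam : {fset I} -> I -> 'rV[R]_n).
Hypothesis fanT : fan q T.
Hypothesis dualT : forall s, s \in T -> dual q s (lam s).
Hypothesis sizeT : forall s, s \in T -> #|` s| = n.

Definition complete := forall x : 'rV[R]_n, exists t a, [/\ t \in T, coef t a & x = comb q t a].

(** Points just beyond the wall lie in some cone, and one cone [t] serves for arbitrarily small
    distances. It then contains the relative interior point [x0] of the wall, hence all generators
    of the wall. *)
Lemma complete_walls : complete -> walls_shared q T lam.
Proof.
move=> cT s i sT is_.
have [sE sd] := dualT sT.
pose x0 := comb q s (restr (s `\ i) (fun=> 1)).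
have li0 : dot (lam s i) x0 = 0.
  by rewrite (dual_comb _ (dualT sT)) // /restr !inE eqxx.
have [|t tT tP] := @pigeonhole_small R _ T (fun t e => in_cone lam t (x0 - e *: q i)).
  move=> e e0; have [t [a [tT [a0 at_] xE]]] := cT (x0 - e *: q i).
  by exists t => // k kt; rewrite xE (dual_comb _ (dualT tT)).
have [tE td] := dualT tT.
(* Cones are closed: a coordinate negative at [x0] would remain negative for small [e]. *)
have x0t : in_cone lam t x0.
  move=> k kt; rewrite leNgt; apply/negP => neg.
  pose w := dot (lam t k) (q i).
  have w0 : 0 < `|w| + 1 by rewrite ltr_wpDl.
  have [|e [e0 ee /(_ k kt)]] := tP (- dot (lam t k) x0 / (`|w| + 1)).
    by rewrite divr_gt0 // oppr_gt0.
  rewrite dotBr dotZr -/w; move: ee; rewrite ler_pdivlMr // mulrDr mulr1 => h1 h2.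
  have : - (e * w) <= e * `|w| by rewrite -mulrN ler_wpM2l ?(ltW e0) // -normrN ler_norm.
  lra.
have sub : s `\ i `<=` t.
  apply/fsubsetP => k ksi.
  have ss : s `\ i `<=` s := fsubD1set s i.
  have := fanT sT tT (coefS ss (coef_restr (a := fun=> 1) (fun _ _ => ler01)))
    (coef_restr (fun k kt => x0t k kt)) _ k.
  rewrite comb_restr -tE => /(_ erefl); rewrite /restr ksi.
  by case: ifP => // _ /eqP; rewrite oner_eq0.
have [e [e0 _ xe]] := tP 1 ltr01.
have lie : dot (lam s i) (x0 - e *: q i) = - e.
  by rewrite dotBr dotZr li0 sd // eqxx mulr1 sub0r.
have ts : t != s.
  by apply/eqP => ts; have := xe i; rewrite ts is_ lie oppr_ge0 leNgt e0 => /(_ isT).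
have [|j js tE'] := fset_exchange is_ _ sub ts; first by rewrite !sizeT.
exists t, j; split=> //.
have jt : j \in t by rewrite tE' !inE eqxx.
have : dot (lam s i) (x0 - e *: q i) < 0 by rewrite lie oppr_lt0.
rewrite [x0 - _]tE dot_comb (big_fsetD1 j) //= big_seq big1 ?addr0.
  have := xe j jt; rewrite le_eqVlt => /orP[/eqP <-|b0]; first by rewrite mul0r ltxx.
  by rewrite pmulr_rlt0.
move=> k; rewrite tE' !inE => /andP[kj]; rewrite (negbTE kj) /= => /andP[ki ks].
by rewrite sd // eq_sym (negbTE ki) mulr0.
Qed.

(** Two distinct cones on the same side of a common wall would overlap near it, against uniqueness
    of coefficients. *)
Lemma ridge_walls :
  (forall s i, s \in T -> i \in s -> exists t, [/\ t \in T, t != s & s `\ i `<=` t]) ->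
  walls_shared q T lam.
Proof.
move=> ridge s i sT is_; have [t [tT ts sub]] := ridge s i sT is_.
have [|j js tE] := fset_exchange is_ _ sub ts; first by rewrite !sizeT.
have [sE sd] := dualT sT.
exists t, j; split=> //; rewrite ltNge; apply/negP => pos.
(* Adding [M] times the wall generators to [q j] makes all its coordinates in [s] nonnegative: the
   result is a point of both cones, with coefficient 0 at [j] in one and 1 in the other. *)
pose M := \sum_(k <- s) `|dot (lam s k) (q j)|.
have M0 : 0 <= M by apply: sumr_ge0.
have jt : j \in t by rewrite tE !inE eqxx.
have tj : t `\ j = s `\ i.
  by rewrite tE fsetU1K // !inE (negbTE js) andbF.
have := fanT sT tT (a := restr s (fun k => dot (lam s k) (q j) + M * (k != i)%:R))
  (b := restr t (fun k => if k == j then 1 else M)) _ _ _ j.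
rewrite /restr (negbTE js) jt eqxx => h.
suff /eqP : 0 = 1 :> R by rewrite eq_sym oner_eq0.
apply: h; rewrite -/(restr _ _); first 2 last.
- rewrite !comb_restr combD -sE.
  rewrite [RHS](_ : _ = q j + M *: comb q (s `\ i) (fun=> 1)).
    congr (_ + _); rewrite combZ /comb (big_fsetD1 i) //= eqxx scale0r add0r; congr (_ *: _).
    by rewrite !big_seq; apply: eq_bigr => k; rewrite !inE => /andP[-> _].
  rewrite /comb (big_fsetD1 j) //= eqxx scale1r tj; congr (_ + _).
  rewrite scaler_sumr !big_seq; apply: eq_bigr => k; rewrite !inE => /andP[_ ks].
  rewrite scalerA mulr1 (_ : (k == j) = false) //.
  by apply: contraNF js => /eqP <-.
- apply: coef_restr => k ks; have [->|ki] := eqVneq k i; first by rewrite mulr0 addr0.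
  rewrite mulr1 -lerBlDl sub0r; apply: le_trans (ler_norm _) _.
  by rewrite normrN /M (big_fsetD1 k) //= lerDl sumr_ge0.
by apply: coef_restr => k _; case: ifP.
Qed.
End Walls.

(** * Embedded complexes *)

Section Embedding.
Variables (R : realType) (n : nat) (I : choiceType).
Implicit Types (phi : I -> pt R n) (U : seq {fset I}) (s t : {fset I}) (a b : I -> R).

(** The convex analogue of [fan]; it covers affine independence and intersection in common faces at
    once. *)
Definition embedded phi U := forall s t a b, s \in U -> t \in U -> coef s a -> coef t b ->
  \sum_(i <- s) a i = 1 -> \sum_(i <- t) b i = 1 ->
  comb phi s a = comb phi t b -> forall i, a i = b i.

Definition subfaces U : set {fset I} :=
  [set s | s != fset0 /\ exists2 t, t \in U & fsubset s t]%classic.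

Definition geom_image phi U : set {fset pt R n} :=
  [set (phi @` s)%fset | s in subfaces U]%classic.

Lemma sum_delta1 s i : i \in s -> \sum_(k <- s) delta R i k = 1.
Proof.
move=> is_; rewrite -(@sum_delta R I s i (fun=> 1)) //.
by apply: eq_bigr => k _; rewrite mul1r.
Qed.

Lemma embedded_inj phi U s t i j : embedded phi U -> s \in U -> t \in U ->
  i \in s -> j \in t -> phi i = phi j -> i = j.
Proof.
move=> eU sU tU is_ jt ij.
have := eU s t (delta R i) (delta R j) sU tU (coef_delta _ is_) (coef_delta _ jt).
rewrite !sum_delta1 // !comb_delta // => /(_ erefl erefl ij i).
by rewrite /delta eqxx; case: eqP => // _ /eqP; rewrite oner_eq0.
Qed.

Definition pushforward phi s c (p : pt R n) : R :=
  \sum_(k <- s) if phi k == p then c k else 0.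

Lemma pushforwardE phi s c i : {in s &, injective phi} -> i \in s ->
  pushforward phi s c (phi i) = c i.
Proof.
move=> inj is_; rewrite /pushforward (big_fsetD1 i) //= eqxx big1_seq ?addr0 // => k.
rewrite !inE /= => /andP[ki ks]; case: eqP => // ki'.
by rewrite (inj k i) // eqxx in ki.
Qed.

Lemma conv_image phi s x : {in s &, injective phi} ->
  conv (phi @` s) x <-> exists a, [/\ coef s a, \sum_(i <- s) a i = 1 & x = comb phi s a].
Proof.
move=> inj; split=> [[l [l0 [l1 ->]]]|[a [[a0 as_] a1 ->]]].
  exists (restr s (l \o phi)); split.
  - by apply: coef_restr => i is_; apply/l0/in_imfset.
  - by rewrite sum_restr -l1 big_imfset.
  - by rewrite comb_restr big_imfset.
have lE i : i \in s -> pushforward phi s a (phi i) = a i := pushforwardE _ inj.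
exists (pushforward phi s a); split.
  by move=> p _; apply: sumr_ge0 => k _; case: ifP.
rewrite !big_imfset //=; split.
  by rewrite -a1 !big_seq; apply: eq_bigr => i /lE.
by rewrite /comb !big_seq; apply: eq_bigr => i /lE ->.
Qed.

(** Adding a small multiple of the relation to the barycentric weights gives a second convex
    representation of the barycentre. *)
Lemma embedded_free phi U s c : embedded phi U -> s \in U ->
  \sum_(i <- s) c i = 0 -> comb phi s c = 0 -> forall i, i \in s -> c i = 0.
Proof.
move=> eU sU c0 cc i is_.
pose m := \sum_(k <- s) `|c k| + 1.
have m0 : 0 < m by rewrite ltr_wpDl // sumr_ge0.
pose N := #|` s|%:R : R.
have N0 : 0 < N by rewrite ltr0n cardfs_gt0; apply/fset0Pn; exists i.
pose e := (m * N)^-1.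
have e0 : 0 < e by rewrite invr_gt0 mulr_gt0.
have sN : \sum_(k <- s) N^-1 = 1.
  by rewrite big_const_seq count_predT iter_addr_0 -mulr_natl mulfV ?gt_eqF.
have := eU s s (restr s (fun k => N^-1 + e * c k)) (restr s (fun=> N^-1)) sU sU _ _ _ _ _ i.
rewrite /restr is_ => h.
suff /eqP : N^-1 + e * c i = N^-1 by rewrite -subr_eq0 addrAC subrr add0r mulf_eq0 gt_eqF //= => /eqP.
apply: h; rewrite -/(restr _ _).
- apply: coef_restr => k ks.
  have : `|c k| <= m by rewrite /m (big_fsetD1 k) //= -addrA lerDl addr_ge0 // sumr_ge0.
  have -> : N^-1 = e * m by rewrite /e invfM mulrAC mulVf ?mul1r // gt_eqF.
  by rewrite -mulrDr => ckm; rewrite mulr_ge0 ?(ltW e0) //; move: ckm; rewrite ler_norml => /andP[? _]; lra.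
- by apply: coef_restr => k ks; rewrite invr_ge0 ltW.
- by rewrite sum_restr big_split /= sN -mulr_sumr c0 mulr0 addr0.
- by rewrite sum_restr.
- by rewrite !comb_restr combD combZ cc scaler0 addr0.
Qed.

Lemma embedded_inj_in phi U s : embedded phi U -> s \in U -> {in s &, injective phi}.
Proof. by move=> eU sU i j is_ js; apply: (embedded_inj eU sU sU). Qed.

Lemma geom_image_finite phi U : finite_set (geom_image phi U).
Proof.
apply: (@sub_finite_set _ _ [set` [seq (phi @` s)%fset | t <- U, s <- enum_fset (fpowerset t)]]%classic).
  move=> _ [s [_ [t tU st]] <-] /=; apply/allpairsPdep; exists t, s.
  by split=> //; rewrite fpowersetE.
exact: finite_seq.
Qed.

Lemma embedded_geom phi U : embedded phi U -> geom_complex (geom_image phi U).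
Proof.
move=> eU; split.
- split=> [_ [s [s0 _] <-]|_ t [s [s0 [u uU su]] <-] ts t0].
    by case/fset0Pn: s0 => i is_; apply/fset0Pn; exists (phi i); apply: in_imfset.
  have tE : t = phi @` [fset i in s | phi i \in t].
    apply/fsetP => p; apply/idP/imfsetP => /= [pt|[i]]; last first.
      by rewrite !inE => /andP[_ it] ->.
    have /imfsetP[i is_ pE] := fsubsetP ts _ pt.
    by exists i => //; rewrite !inE is_ -pE.
  exists [fset i in s | phi i \in t] => //; split.
    by apply: contraNneq t0 => e; rewrite tE e imfset0.
  exists u => //; apply/fsubsetP => i; rewrite !inE => /andP[is_ _]; exact: (fsubsetP su).
- move=> _ [s [s0 [u uU su]] <-] l.
  have inj : {in s &, injective phi}.
    by move=> i j is_ js; apply: (embedded_inj eU uU uU); apply: (fsubsetP su).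
  rewrite !big_imfset //= => l0 lv p /imfsetP[i is_ ->].
  have ro k : k \notin s -> restr s (l \o phi) k = 0 by rewrite /restr => /negbTE ->.
  have := embedded_free (c := restr s (l \o phi)) eU uU _ _ (fsubsetP su _ is_).
  rewrite -(sum_widen su ro) -(comb_widen phi su ro) sum_restr comb_restr /restr is_.
  exact.
- move=> _ _ [s [s0 [u uU su]] <-] [t [t0 [w wU tw]] <-].
  have injs : {in s &, injective phi}.
    by move=> i j is_ js; apply: (embedded_inj eU uU uU); apply: (fsubsetP su).
  have injt : {in t &, injective phi}.
    by move=> i j is_ js; apply: (embedded_inj eU wU wU); apply: (fsubsetP tw).
  have -> : (phi @` s) `&` (phi @` t) = phi @` (s `&` t).
    apply/fsetP => p; rewrite inE; apply/andP/imfsetP => /= [[/imfsetP[i is_ ->] /imfsetP[j jt ij]]|[i]].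
      exists i => //; rewrite inE is_ /=.
      by rewrite (embedded_inj eU uU wU (fsubsetP su _ is_) (fsubsetP tw _ jt) ij).
    by rewrite inE => /andP[is_ it] ->; rewrite !in_imfset.
  have injst : {in s `&` t &, injective phi}.
    by move=> i j; rewrite !inE => /andP[is_ _] /andP[js _]; apply: injs.
  apply/seteqP; split=> [x [/(conv_image _ injs)[a [ca a1 xa]] /(conv_image _ injt)[b [cb b1 xb]]]|x
     /(conv_image _ injst)[a [ca a1 xa]]].
    have ab i : a i = b i.
      apply: (eU u w a b uU wU (coefS su ca) (coefS tw cb)).
      - by rewrite -(sum_widen su ca.2).
      - by rewrite -(sum_widen tw cb.2).
      - by rewrite -(comb_widen phi su ca.2) -(comb_widen phi tw cb.2) -xa -xb.
    have a0 i : i \notin s `&` t -> a i = 0.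
      rewrite inE negb_and => /orP[/ca.2//|it]; rewrite ab; exact: cb.2.
    apply/(conv_image _ injst); exists a; split; first by split=> //; exact: ca.1.
      by rewrite (sum_widen (fsubsetIl s t)).
    by rewrite (comb_widen phi (fsubsetIl s t)).
  split.
    apply/(conv_image _ injs); exists a; split; first exact: coefS (fsubsetIl s t) ca.
      by rewrite -(sum_widen (fsubsetIl s t) ca.2).
    by rewrite -(comb_widen phi (fsubsetIl s t) ca.2).
  apply/(conv_image _ injt); exists a; split; first exact: coefS (fsubsetIr s t) ca.
    by rewrite -(sum_widen (fsubsetIr s t) ca.2).
  by rewrite -(comb_widen phi (fsubsetIr s t) ca.2).
- move=> x; exists 1 => //; apply: sub_finite_set (geom_image_finite phi U).
  by move=> s [].
Qed.

Lemma subfaces_vertex U i : vertices (subfaces U) i <-> exists2 t, t \in U & i \in t.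
Proof.
split=> [[_ [t tU]]|[t tU it]]; first by rewrite fsub1set; exists t.
by split; [apply/fset0Pn; exists i; rewrite inE|exists t => //; rewrite fsub1set].
Qed.

Lemma embedded_iso phi U : embedded phi U -> comb_iso (subfaces U) (geom_image phi U) phi.
Proof.
move=> eU.
have inj i j : vertices (subfaces U) i -> vertices (subfaces U) j -> phi i = phi j -> i = j.
  by move=> /subfaces_vertex[s sU is_] /subfaces_vertex[t tU jt]; apply: (embedded_inj eU sU tU).
split=> //.
- by move=> i vi; exists [fset i] => //; rewrite imfset_fset1.
- move=> p [s ss sp]; have [s0 [t tU st]] := ss.
  have /imfsetP[i is_ pE] : p \in phi @` s by rewrite sp inE.
  by exists i => //; apply/subfaces_vertex; exists t => //; apply: (fsubsetP st).
- move=> S Sv; split=> [SU|[s ss sS]]; first by exists S.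
  suff -> : S = s by [].
  have sv i : i \in s -> vertices (subfaces U) i.
    move=> is_; case: ss => _ [t tU st]; apply/subfaces_vertex; exists t => //; exact: (fsubsetP st).
  apply/fsetP => i; apply/idP/idP => ii.
    have : phi i \in phi @` s by rewrite sS in_imfset.
    by case/imfsetP => j js ij; rewrite (inj i j) //; [exact: Sv|exact: sv].
  have : phi i \in phi @` S by rewrite -sS in_imfset.
  by case/imfsetP => j js ij; rewrite (inj i j) //; [exact: sv|exact: Sv].
Qed.

Lemma carrier_image phi U x : embedded phi U ->
  carrier (geom_image phi U) x <->
  exists s a, [/\ s \in U, coef s a, \sum_(i <- s) a i = 1 & x = comb phi s a].
Proof.
move=> eU; split=> [[_ [s [s0 [t tU st]] <-]]|[s [a [sU ca a1 xE]]]].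
  have inj : {in s &, injective phi}.
    by move=> i j is_ js; apply: (embedded_inj eU tU tU); apply: (fsubsetP st).
  move=> /(conv_image _ inj)[a [ca a1 xa]]; exists t, a; split=> //.
  - exact: coefS ca.
  - by rewrite -(sum_widen st ca.2).
  - by rewrite -(comb_widen phi st ca.2).
exists (phi @` s); last by apply/(conv_image _ (embedded_inj_in eU sU)); exists a.
exists s => //; split; last by exists s.
apply/eqP => s0; move: a1; rewrite s0 big_seq_fset0 => /eqP.
by rewrite eq_sym oner_eq0.
Qed.

Lemma iso_image phi U L : geom_complex L -> comb_iso (subfaces U) L phi ->
  L = geom_image phi U.
Proof.
move=> [[L0 Ls] _ _ _] [inj vL vK iso].
have vS s t : t \in U -> s `<=` t -> forall i, i \in s -> vertices (subfaces U) i.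
  by move=> tU st i is_; apply/subfaces_vertex; exists t => //; apply: (fsubsetP st).
apply/seteqP; split=> [s Ls_|_ [s ss <-]]; last first.
  by have [_ [t tU st]] := ss; apply/(iso s) => //; exact: vS st.
have vs p : p \in s -> exists2 i, vertices (subfaces U) i & phi i = p.
  move=> ps; apply: vK; apply: Ls Ls_ _ _; first by rewrite fsub1set.
  by apply/fset0Pn; exists p; rewrite inE.
have [p0 /vs[i0 _ _]] := fset0Pn _ (L0 _ Ls_).
have /choice[f fP] : forall p : pt R n, exists i, p \in s ->
    vertices (subfaces U) i /\ phi i = p.
  move=> p; have [/vs[i vi ip]|ps] := boolP (p \in s); last by exists i0.
  by exists i.
have sE : phi @` (f @` s) = s.
  apply/fsetP => p; apply/imfsetP/idP => /= [[_ /imfsetP[p' ps ->] ->]|ps].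
    by have [_ ->] := fP p' ps.
  by exists (f p); [apply: in_imfset|have [_ ->] := fP p ps].
exists (f @` s) => //; apply/(iso (f @` s)); rewrite ?sE //.
by move=> _ /imfsetP[p ps ->]; have [] := fP p ps.
Qed.

(** A point with two representations lies, by the intersection axiom, in the hull of the common
    face; by affine independence both representations equal the one over that face. *)
Lemma iso_embedded phi U L : geom_complex L -> comb_iso (subfaces U) L phi ->
  embedded phi U.
Proof.
move=> gL iso s t a b sU tU ca cb a1 b1 ab.
have LE := iso_image gL iso; case: gL => _ aff int _; case: iso => inj _ _ _.
have vU s' i : s' \in U -> i \in s' -> vertices (subfaces U) i.
  by move=> s'U is'; apply/subfaces_vertex; exists s'.
have injU s' : s' \in U -> {in s' &, injective phi}.
  by move=> s'U i j is' js'; apply: inj; apply: (vU s').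
have LU s' c : s' \in U -> \sum_(i <- s') c i = 1 :> R -> L (phi @` s').
  move=> s'U c1; rewrite LE; exists s' => //; split; last by exists s'.
  by apply/eqP => s0; move: c1; rewrite s0 big_seq_fset0 => /eqP; rewrite eq_sym oner_eq0.
have Ls := LU s a sU a1; have Lt := LU t b tU b1.
have stE : (phi @` s) `&` (phi @` t) = phi @` (s `&` t).
  apply/fsetP => p; rewrite inE; apply/andP/imfsetP => /= [[/imfsetP[i is_ ->] /imfsetP[j jt ij]]|[i]].
    by exists i => //; rewrite inE is_ /= (inj i j) //; [exact: vU sU is_|exact: vU tU jt].
  by rewrite inE => /andP[is_ it] ->; rewrite !in_imfset.
have uniq_coef s' c d : s' \in U -> L (phi @` s') -> coef s' c -> coef s' d ->
    \sum_(i <- s') c i = 1 -> \sum_(i <- s') d i = 1 -> comb phi s' c = comb phi s' d ->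
    forall i, c i = d i.
  move=> s'U Ls' [_ cs] [_ ds] c1 d1 cd i.
  have [is'|is'] := boolP (i \in s'); last by rewrite cs // ds.
  pose l := pushforward phi s' (fun k => c k - d k).
  have lE k : k \in s' -> l (phi k) = c k - d k := pushforwardE _ (injU _ s'U).
  have := aff _ Ls' l _ _ (phi i) (in_imfset _ _ is').
  rewrite !big_imfset ?lE //=; try exact: injU.
  move=> h; apply/eqP; rewrite -subr_eq0; apply/eqP; apply: h.
    rewrite big_seq (eq_bigr (fun k => c k - d k)) => [|k /lE //].
    by rewrite -big_seq sumrB c1 d1 subrr.
  rewrite big_seq (eq_bigr (fun k => c k *: phi k - d k *: phi k)) => [|k /lE ->]; last by rewrite scalerBl.
  by rewrite -big_seq sumrB; apply/eqP; rewrite subr_eq0; apply/eqP.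
have : (conv (phi @` s)%fset `&` conv (phi @` t)%fset)%classic (comb phi s a).
  split; first by apply/(conv_image _ (injU _ sU)); exists a.
  by apply/(conv_image _ (injU _ tU)); exists b.
rewrite int // stE => /conv_image[|c [cc c1 ac]].
  by move=> i j; rewrite !inE => /andP[is_ _] /andP[js _]; apply: (injU _ sU).
have Is := fsubsetIl s t; have It := fsubsetIr s t.
move=> i; transitivity (c i).
  apply: (uniq_coef s) => //; first exact: coefS cc.
    by rewrite -(sum_widen Is cc.2).
  by rewrite ac (comb_widen phi Is cc.2).
apply: (uniq_coef t) => //; first exact: coefS cc.
  by rewrite -(sum_widen It cc.2).
by rewrite -ab ac (comb_widen phi It cc.2).
Qed.

End Embedding.

(** * Stars of a vertex as truncated fans *)

Section Star.
Variables (R : realType) (n : nat) (I : choiceType).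
Implicit Types (phi q : I -> pt R n) (T : seq {fset I}) (s t : {fset I}) (a b : I -> R).

Lemma fan_neq0 q T s i : fan q T -> s \in T -> i \in s -> q i != 0.
Proof.
move=> fT sT is_; apply/eqP => q0.
have := fan_free fT sT (c := delta R i); rewrite comb_delta // => /(_ q0 i is_).
by rewrite /delta eqxx => /eqP; rewrite oner_eq0.
Qed.

Lemma fan_inj q T s t i j : fan q T -> s \in T -> t \in T -> i \in s -> j \in t ->
  q i = q j -> i = j.
Proof.
move=> fT sT tT is_ jt ij.
have := fT s t (delta R i) (delta R j) sT tT (coef_delta _ is_) (coef_delta _ jt).
rewrite !comb_delta // => /(_ ij i).
by rewrite /delta eqxx; case: eqP => // _ /eqP; rewrite oner_eq0.
Qed.

Lemma fan_embedded q T : fan q T -> embedded q T.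
Proof. by move=> fT s t a b sT tT ca cb _ _; apply: fT. Qed.

Section Scale.
Variables (q : I -> pt R n) (T : seq {fset I}) (k : I -> R).
Hypothesis k0 : forall t i, t \in T -> i \in t -> 0 < k i.

Lemma comb_scale s a : comb (fun i => k i *: q i) s a = comb q s (fun i => a i * k i).
Proof. by apply: eq_bigr => i _; rewrite scalerA. Qed.

(** Inversion moves each vertex along its ray, so this transports the fan through an inversion. *)
Lemma fan_scale : fan q T -> fan (fun i => k i *: q i) T.
Proof.
move=> fT s t a b sT tT ca cb; rewrite !comb_scale => h i.
have co (u : {fset I}) (c : I -> R) : u \in T -> coef u c -> coef u (restr u (fun i => c i * k i)).
  by move=> uT [c0 _]; apply: coef_restr => l lu; rewrite mulr_ge0 // ltW // (k0 uT lu).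
have := fT _ _ _ _ sT tT (co _ _ sT ca) (co _ _ tT cb); rewrite !comb_restr => /(_ h i).
rewrite /restr; have [is_|is_] := boolP (i \in s); have [it|it] := boolP (i \in t).
- by move/(mulIf (lt0r_neq0 (k0 sT is_))).
- rewrite (cb.2 i it) => /eqP; rewrite mulf_eq0 (negbTE (lt0r_neq0 (k0 sT is_))) orbF.
  by move/eqP.
- rewrite (ca.2 i is_) => /esym/eqP; rewrite mulf_eq0 (negbTE (lt0r_neq0 (k0 tT it))) orbF.
  by move/eqP.
by rewrite ca.2 // cb.2.
Qed.

Lemma complete_scale : complete q T -> complete (fun i => k i *: q i) T.
Proof.
move=> cT x; have [t [a [tT [a0 at_] ->]]] := cT x.
exists t, (restr t (fun i => a i / k i)); split=> //.
  by apply: coef_restr => i it; rewrite divr_ge0 // ltW // (k0 tT it).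
rewrite comb_restr comb_scale; apply: eq_comb => i it.
by rewrite divfK // lt0r_neq0 // (k0 tT it).
Qed.
End Scale.

Section Cone.
Variables (phi : I -> pt R n) (T : seq {fset I}) (v0 : I).
Hypothesis v0T : forall t, t \in T -> v0 \notin t.
Let star := [seq v0 |` t | t <- T].
Let q i := phi i - phi v0.

Lemma star_comb s a : v0 \notin s -> \sum_(i <- v0 |` s) a i = 1 ->
  comb phi (v0 |` s) a = phi v0 + comb q s a.
Proof.
move=> v0s; rewrite /comb !big_fsetU1 //= => a1.
have -> : a v0 = 1 - \sum_(i <- s) a i by rewrite -a1 addrK.
rewrite scalerBl scale1r -addrA; congr (_ + _).
rewrite scaler_suml -sumrN -big_split; apply: eq_bigr => i _ /=.
by rewrite /q scalerBr addrC.
Qed.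

Definition cone_coef s a : I -> R :=
  fun i => if i == v0 then 1 - \sum_(k <- s) a k else a i.

Lemma cone_coefP s a : v0 \notin s -> coef s a -> \sum_(k <- s) a k <= 1 ->
  [/\ coef (v0 |` s) (cone_coef s a), \sum_(i <- v0 |` s) cone_coef s a i = 1 &
      comb phi (v0 |` s) (cone_coef s a) = phi v0 + comb q s a].
Proof.
move=> v0s [a0 as_] a1.
have E i : i \in s -> cone_coef s a i = a i.
  by rewrite /cone_coef; case: eqP => // -> v0s'; rewrite v0s' in v0s.
have s1 : \sum_(i <- v0 |` s) cone_coef s a i = 1.
  have -> : \sum_(i <- v0 |` s) cone_coef s a i = cone_coef s a v0 + \sum_(i <- s) a i.
    by rewrite big_fsetU1 //= !big_seq; congr (_ + _); apply: eq_bigr => i /E.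
  by rewrite /cone_coef eqxx subrK.
split=> //.
  split=> i; rewrite /cone_coef; first by case: eqP => // _; rewrite subr_ge0.
  by rewrite !inE negb_or => /andP[/negbTE -> /as_].
by rewrite star_comb // (eq_comb q E).
Qed.

Lemma fan_star : fan q T -> embedded phi star.
Proof.
move=> fT _ _ a b /mapP[s sT ->] /mapP[t tT ->] ca cb a1 b1.
have v0s := v0T sT; have v0t := v0T tT.
rewrite !star_comb // => /addrI h.
have co (u : {fset I}) (c : I -> R) : v0 \notin u -> coef (v0 |` u) c -> coef u (restr u c).
  by move=> v0u [c0 _]; exact: coef_restr.
have := fT _ _ _ _ sT tT (co _ _ v0s ca) (co _ _ v0t cb); rewrite !comb_restr => /(_ h) ab.
have ab' i : i != v0 -> a i = b i.
  move=> iv; have := ab i; rewrite /restr.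
  have off (u : {fset I}) (c : I -> R) : coef (v0 |` u) c -> i \notin u -> c i = 0.
    by move=> [_ cu] iu; apply: cu; rewrite !inE negb_or iv.
  by case: (boolP (i \in s)) => [_|/(off _ _ ca) ->]; case: (boolP (i \in t)) => [_|/(off _ _ cb) ->].
move=> i; have [->|/ab'//] := eqVneq i v0.
have wid (u : {fset I}) (c : I -> R) : coef (v0 |` u) c -> u `<=` v0 |` (s `|` t) ->
    \sum_(j <- v0 |` u) c j = \sum_(j <- v0 |` (s `|` t)) c j.
  move=> [_ cu] uu; apply: sum_widen => //.
  by apply/fsubsetP => j; rewrite inE => /orP[|/(fsubsetP uu)//]; rewrite !inE => ->.
have v0st : v0 \notin s `|` t by rewrite inE negb_or v0s.
move: a1 b1; rewrite (wid s a) ?(wid t b) //; last 2 first.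
- by apply/fsubsetP => j; rewrite !inE => ->; rewrite !orbT.
- by apply/fsubsetP => j; rewrite !inE => ->; rewrite !orbT.
rewrite !big_fsetU1 //= => a1 b1.
have : \sum_(j <- s `|` t) a j = \sum_(j <- s `|` t) b j.
  rewrite !big_seq; apply: eq_bigr => j jst; apply: ab'.
  by apply: contraNneq v0st => <-.
by move=> e; apply: (addIr (\sum_(j <- s `|` t) a j)); rewrite a1 e b1.
Qed.

(** Cone coefficients have arbitrary totals; a common factor [M^-1] brings both totals below 1, and
    the missing weight goes to [v0]. *)
Lemma star_fan : embedded phi star -> fan q T.
Proof.
move=> eS s t a b sT tT ca cb ab i.
have v0s := v0T sT; have v0t := v0T tT.
pose M := \sum_(j <- s) a j + \sum_(j <- t) b j + 1.
have sa : 0 <= \sum_(j <- s) a j by apply: sumr_ge0 => j _; case: ca.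
have sb : 0 <= \sum_(j <- t) b j by apply: sumr_ge0 => j _; case: cb.
have M0 : 0 < M by rewrite /M; lra.
have Mi : 0 <= M^-1 by rewrite invr_ge0 ltW.
have [|ca1 a1 aE] := cone_coefP v0s (coefZ Mi ca).
  by rewrite -mulr_sumr mulrC ler_pdivrMr // mul1r /M; lra.
have [|cb1 b1 bE] := cone_coefP v0t (coefZ Mi cb).
  by rewrite -mulr_sumr mulrC ler_pdivrMr // mul1r /M; lra.
have inS u : u \in T -> v0 |` u \in star by move=> uT; apply: map_f.
have := eS _ _ _ _ (inS _ sT) (inS _ tT) ca1 cb1 a1 b1.
rewrite aE bE !combZ ab => /(_ erefl i); rewrite /cone_coef.
case: eqP => [->|_]; first by rewrite ca.2 // cb.2.
by move/(mulfI (lt0r_neq0 (_ : 0 < M^-1))); apply; rewrite invr_gt0.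
Qed.

Lemma star_interior_complete : embedded phi star ->
  interior_pt (carrier (geom_image phi star)) (phi v0) -> complete q T.
Proof.
move=> eS [d d0 dP] x.
have [e e0 he] := near_dir (phi v0) x d0.
have := dP _ (he e (ltW e0) (lexx _)) => /(carrier_image _ eS)[_ [a [/mapP[t tT ->] [a0 at_] a1]]].
rewrite star_comb ?v0T // => /addrI xE.
exists t, (fun i => e^-1 * restr t a i); split=> //.
  by apply: coefZ; [rewrite invr_ge0 ltW|apply: coef_restr].
by rewrite combZ comb_restr -xE scalerA mulVf ?scale1r // lt0r_neq0.
Qed.

(** The form [c s] computes coefficient totals in the cone of [s]. Near the apex all these forms are
    below 1, so the cone point lies in the simplex. *)
Lemma complete_star_interior (lam : {fset I} -> I -> pt R n) : fan q T ->
  (forall s, s \in T -> dual q s (lam s)) -> complete q T ->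
  interior_pt (carrier (geom_image phi star)) (phi v0).
Proof.
move=> fT dT cT.
pose c s := \sum_(i <- s) lam s i.
have [|d d0 dP] := @near_dot R n _ T (fun s => - c s) (fun=> -1) 0.
  by move=> s _; rewrite dot0r oppr_lt0.
exists d => // y yd.
have [t [a [tT ca yE]]] := cT (y - phi v0).
have [|ca1 a1 aE] := @cone_coefP t a (v0T tT) ca.
  have := dP (y - phi v0) _ t tT; rewrite dotNl ltrN2 => h; apply/ltW.
  rewrite (_ : \sum_(k <- t) a k = dot (c t) (y - phi v0)).
    by apply: h; rewrite edistC -edist0 edistC.
  rewrite yE dot_suml !big_seq; apply: eq_bigr => i it; by rewrite (dual_comb _ (dT _ tT)).
apply/(carrier_image _ (fan_star fT)); exists (v0 |` t), (cone_coef t a); split=> //.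
  by apply: map_f.
by rewrite aE -yE addrC subrK.
Qed.

(** If [phi i] could be moved slightly away from [phi v0] within the star, then [phi i] would have a
    representation with positive weight at [v0]. *)
Lemma star_interior_apex t i : embedded phi star -> t \in T -> i \in v0 |` t ->
  interior_pt (carrier (geom_image phi star)) (phi i) -> i = v0.
Proof.
move=> eS tT it [d d0 dP]; apply: contrapT => /eqP iv.
have [e e0 he] := near_dir (phi i) (phi i - phi v0) d0.
have := dP _ (he e (ltW e0) (lexx _)) => /(carrier_image _ eS)[_ [b [/mapP[s sT ->] cb b1 xE]]].
have v0s : v0 \in v0 |` s by rewrite !inE eqxx.
have e1 : 0 < 1 + e by rewrite addr_gt0.
have ei : 0 <= (1 + e)^-1 by rewrite invr_ge0 ltW.
have inS u : u \in T -> v0 |` u \in star by move=> uT; apply: map_f.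
have := eS _ _ (delta R i) (fun k => (1 + e)^-1 * (b k + e * delta R v0 k)) (inS _ tT) (inS _ sT)
  (coef_delta _ it) (coefZ ei (coefD cb (coefZ (ltW e0) (coef_delta _ v0s)))).
rewrite sum_delta1 // -mulr_sumr big_split -mulr_sumr /= sum_delta1 // b1 mulr1 mulVf ?lt0r_neq0 //.
rewrite combZ combD combZ -xE !comb_delta // => /(_ erefl erefl) h.
have {}h := h _ v0; rewrite /delta eqxx eq_sym (negbTE iv) mulr1 in h.
have : 0 < (1 + e)^-1 * (b v0 + e).
  by rewrite mulr_gt0 ?invr_gt0 // ltr_wpDl //; case: cb.
rewrite -h ?ltxx //.
rewrite -[LHS]scale1r -[X in X *: _ = _](mulVf (lt0r_neq0 e1)) -scalerA; congr (_ *: _).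
by rewrite scalerBr scalerDl scale1r -addrA subrK.
Qed.
End Cone.
End Star.

(** * Convex hulls and their boundaries *)

Section Hull.
Variables (R : realType) (n : nat).
Implicit Types (x y z o : pt R n) (F : {fset pt R n}).

Lemma normD x y : edist (x + y) 0 <= edist x 0 + edist y 0.
Proof.
apply: le_trans (edist_triangle _ y _) _.
by rewrite -[X in edist _ X]add0r edist_addr.
Qed.

Lemma normZ (r : R) x : 0 <= r -> edist (r *: x) 0 = r * edist x 0.
Proof. by move=> r0; rewrite -[X in edist _ X](scaler0 _ r) edistZ ger0_norm. Qed.

Lemma edist_sum (J : Type) (s : seq J) (a : J -> R) (x y : J -> pt R n) :
  (forall j, 0 <= a j) ->
  edist (\sum_(j <- s) a j *: x j) (\sum_(j <- s) a j *: y j) <=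
  \sum_(j <- s) a j * edist (x j) (y j).
Proof.
move=> a0; rewrite edist0 -sumrB; elim: s => [|j s IH].
  by rewrite !big_nil edistxx.
rewrite !big_cons; apply: le_trans (normD _ _) _; apply: lerD => //.
by rewrite -scalerBr normZ // -edist0.
Qed.

Lemma conv_sum F (J : Type) (s : seq J) (a : J -> R) (y : J -> pt R n) :
  (forall j, 0 <= a j) -> \sum_(j <- s) a j = 1 -> (forall j, conv F (y j)) ->
  conv F (\sum_(j <- s) a j *: y j).
Proof.
move=> a0 a1 /choice[l lP].
exists (fun p => \sum_(j <- s) a j * l j p); split.
  by move=> p pF; apply: sumr_ge0 => j _; rewrite mulr_ge0 //; have [+ _] := lP j; apply.
split.
  rewrite exchange_big /= -a1; apply: eq_bigr => j _.
  by rewrite -mulr_sumr; have [_ [-> _]] := lP j; rewrite mulr1.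
under [RHS]eq_bigr => p _ do rewrite scaler_suml.
rewrite exchange_big /=; apply: eq_bigr => j _.
have [_ [_ ->]] := lP j; rewrite scaler_sumr; apply: eq_bigr => p _.
by rewrite scalerA.
Qed.

Lemma conv_vertex F p : p \in F -> conv F p.
Proof.
move=> pF; exists (delta R p); split; first by move=> k _; case: (coef_delta R pF).
by split; [rewrite sum_delta1|rewrite -[LHS](comb_delta id pF)].
Qed.

Lemma conv_line F x y (t : R) : conv F x -> conv F y -> 0 <= t -> t <= 1 ->
  conv F (x + t *: (y - x)).
Proof.
move=> Fx Fy t0 t1.
have := @conv_sum F bool [:: true; false] (fun b => if b then t else 1 - t) (fun b => if b then y else x).
rewrite !big_cons !big_nil !addr0 /= => h.
have -> : x + t *: (y - x) = t *: y + (1 - t) *: x.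
  by apply/rowP => i; rewrite !mxE; ring.
by apply: h => [[]||[]] //; rewrite ?subr_ge0 // addrC subrK.
Qed.

Lemma closure_conv F x : conv F x -> closure_pt (conv F) x.
Proof. by move=> Fx d d0; exists x => //; rewrite edistxx. Qed.

Lemma closure_sum F (J : Type) (s : seq J) (a : J -> R) (y : J -> pt R n) :
  (forall j, 0 <= a j) -> \sum_(j <- s) a j = 1 ->
  (forall j, a j = 0 \/ closure_pt (conv F) (y j)) -> (exists x, conv F x) ->
  closure_pt (conv F) (\sum_(j <- s) a j *: y j).
Proof.
move=> a0 a1 yF [x0 Fx0] d d0.
have d2 : 0 < d / 2 by rewrite divr_gt0.
have /choice[z zP] : forall j, exists z, conv F z /\ (a j = 0 \/ edist (y j) z < d / 2).
  move=> j; have [aj|/(_ _ d2)[z Fz yz]] := yF j; first by exists x0; split=> //; left.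
  by exists z; split=> //; right.
exists (\sum_(j <- s) a j *: z j); first by apply: conv_sum => // j; have [] := zP j.
apply: le_lt_trans (edist_sum _ _ _ a0) _.
apply: (@le_lt_trans _ _ (\sum_(j <- s) a j * (d / 2))).
  apply: ler_sum => j _; have [_ [->|/ltW yz]] := zP j; first by rewrite !mul0r.
  by rewrite ler_wpM2l.
by rewrite -mulr_suml a1 mul1r; lra.
Qed.

Lemma interior_segment F o y (t : R) :
  interior_pt (conv F) o -> closure_pt (conv F) y -> 0 <= t -> t < 1 ->
  interior_pt (conv F) (o + t *: (y - o)).
Proof.
move=> [d d0 dP] cy t0 t1.
have u0 : 0 < 1 - t by rewrite subr_gt0.
pose r := (1 - t) * d / 2.
have r0 : 0 < r by rewrite divr_gt0 // mulr_gt0.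
have [y' Fy' yy'] := cy r r0.
exists r => // w wr; pose z := o + t *: (y - o).
(* The perturbation of the target is absorbed by the interior endpoint, which moves by less than
   [d]. *)
pose o' := o + (1 - t)^-1 *: ((w - z) + t *: (y - y')).
have -> : w = o' + t *: (y' - o').
  have -> : o' + t *: (y' - o') = (1 - t) *: o' + t *: y'.
    by apply/rowP => i; rewrite !mxE; ring.
  rewrite /o' scalerDr scalerA divff ?lt0r_neq0 // scale1r /z.
  apply/rowP => i; rewrite !mxE; ring.
apply: conv_line => //; last exact: ltW.
apply: dP; rewrite /o' edistC edist0 addrAC subrr add0r normZ ?invr_ge0 ?(ltW u0) //.
rewrite mulrC ltr_pdivrMr // mulrC.
apply: le_lt_trans (normD _ _) _; rewrite normZ // -!edist0 edistC.
have : t * edist y y' <= edist y y' by rewrite ler_piMl ?edist_ge0 // ltW.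
by move: wr yy'; rewrite -/z /r; lra.
Qed.

Lemma boundary_ray F o x y (t : R) : interior_pt (conv F) o -> 0 < t ->
  boundary_pt (conv F) x -> boundary_pt (conv F) y -> y - o = t *: (x - o) -> t = 1.
Proof.
move=> oi t0 [cx nx] [cy ny] yx.
case: (ltgtP t 1) => // t1.
  by case: ny; rewrite -(subrK o y) addrC yx; apply: interior_segment => //; apply: ltW.
case: nx; have -> : x = o + t^-1 *: (y - o).
  by rewrite yx scalerA mulVf ?lt0r_neq0 // scale1r addrC subrK.
by apply: interior_segment; rewrite ?invr_ge0 ?(ltW t0) // invf_lt1.
Qed.

Lemma conv_dot_bound F a : exists B : R, forall x, conv F x -> dot a x <= B.
Proof.
exists (\sum_(p <- F) `|dot a p|) => x [l [l0 [l1 ->]]].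
rewrite dot_sumr !big_seq; apply: ler_sum => p pF; rewrite dotZr.
apply: le_trans (ler_norm _) _; rewrite normrM ger0_norm ?l0 // ler_piMl //.
rewrite -l1 (big_fsetD1 p) //= lerDl big_seq sumr_ge0 // => k.
by rewrite !inE => /andP[_ /l0].
Qed.

Lemma ray_boundary F o x : interior_pt (conv F) o -> x != 0 ->
  exists2 t : R, 0 < t & boundary_pt (conv F) (o + t *: x).
Proof.
move=> [d d0 dP] x0.
have xx : 0 < dot x x by rewrite dot_gt0.
have [B BP] := conv_dot_bound F x.
pose S := [set t : R | 0 <= t /\ conv F (o + t *: x)]%classic.
have Fo : conv F o by apply: dP; rewrite edistxx.
have [e e0 he] := near_dir o x d0.
have Se : S e by split; [exact: ltW|apply/dP/he => //; exact: ltW].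
have supS : has_sup S.
  split; first by exists e.
  exists ((B - dot x o) / dot x x) => t [t0 /BP].
  by rewrite dotDr dotZr ler_pdivlMr //; lra.
have te : e <= sup S by apply: sup_upper_bound.
exists (sup S); first exact: lt_le_trans te.
split=> [r r0|[r r0 rP]].
  have [e1 e10 he1] := near_dir (o + sup S *: x) (- x) r0.
  have [t [t0 Ft] tS] := sup_adherent e10 supS.
  exists (o + t *: x) => //.
  have -> : o + t *: x = o + sup S *: x + (sup S - t) *: (- x).
    by apply/rowP => i; rewrite !mxE; ring.
  by apply: he1; [rewrite subr_ge0; apply: sup_upper_bound|lra].
have [e1 e10 he1] := near_dir (o + sup S *: x) x r0.
have : S (sup S + e1).
  split; first by rewrite addr_ge0 ?(ltW e10) // (le_trans _ te) // ltW.
  by rewrite scalerDl addrA; apply/rP/he1 => //; exact: ltW.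
by move/(sup_upper_bound supS); lra.
Qed.

Definition homog (x : pt R n) : 'rV[R]_n.+1 :=
  \row_j if unlift ord0 j is Some i then x ord0 i else 1.

Lemma sum_homog (w : 'I_n.+1 -> R) x :
  \sum_j homog x ord0 j * w j = w ord0 + dot (\row_i w (lift ord0 i)) x.
Proof.
rewrite big_ord_recl mxE unlift_none mul1r; congr (_ + _).
by apply: eq_bigr => i _; rewrite !mxE liftK mulrC.
Qed.

Lemma homog_inj : injective homog.
Proof.
move=> x y /rowP xy; apply/rowP => i.
by have := xy (lift ord0 i); rewrite !mxE liftK.
Qed.

Lemma homog_sum (J : Type) (s : seq J) (a : J -> R) (y : J -> pt R n) :
  \sum_(j <- s) a j = 1 -> homog (\sum_(j <- s) a j *: y j) = \sum_(j <- s) a j *: homog (y j).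
Proof.
move=> a1; apply/rowP => j; rewrite !mxE !summxE.
case: unliftP => [i ->|->]; last first.
  by rewrite -[LHS]a1; apply: eq_bigr => k _; rewrite !mxE unlift_none mulr1.
by rewrite summxE; apply: eq_bigr => k _; rewrite !mxE liftK.
Qed.

(** If the homogenised points have full rank, [n.+1] of them are affinely independent and their
    centroid is interior, as barycentric coordinates are affine. Otherwise a vector of the kernel is
    the equation of a hyperplane. *)
Lemma flat_hull F : F != fset0 -> (forall o, ~ interior_pt (conv F) o) ->
  exists (a : pt R n) (b : R), a != 0 /\ forall p, p \in F -> dot a p = b.
Proof.
move=> F0 noint; pose r := size (enum_fset F).
pose e (k : 'I_r) : pt R n := tnth (in_tuple (enum_fset F)) k.
have eF k : e k \in F by exact: mem_tnth.
have Fe p : p \in F -> exists k, e k = p by move=> /(tnthP (in_tuple (enum_fset F)))[k ->]; exists k.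
pose M : 'M[R]_(r, n.+1) := \matrix_k homog (e k).
have [full|] := boolP (row_full M); last first.
  rewrite -col_leq_rank -ltnNge => rk.
  have : kermx M^T != 0 by rewrite -mxrank_eq0 mxrank_ker mxrank_tr -lt0n subn_gt0.
  move=> /rowV0Pn[w /sub_kermxP wM w0].
  exists (\row_i w ord0 (lift ord0 i)), (- w ord0 ord0).
  have key p : p \in F -> dot (\row_i w ord0 (lift ord0 i)) p = - w ord0 ord0.
    move=> /Fe[k <-]; apply/eqP; rewrite -subr_eq0 opprK addrC -sum_homog; apply/eqP.
    have := congr1 (fun u : 'rV_r => u ord0 k) wM; rewrite !mxE => h; rewrite -[RHS]h.
    by apply: eq_bigr => j _; rewrite !mxE mulrC.
  split=> //; apply: contra w0 => /eqP a0.
  have /fset0Pn[p pF] := F0; have := key p pF; rewrite a0 dot0l => /esym/eqP; rewrite oppr_eq0 => /eqP b0.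
  apply/eqP/rowP => j; rewrite mxE; case: (unliftP ord0 j) => [i ->|-> //].
  by have /rowP/(_ i) := a0; rewrite !mxE.
pose f := fullrankfun full.
pose A := rowsub f M.
have uA : A \in unitmx by exact: fullrowsub_unit.
have N0 : 0 < n.+1%:R :> R by rewrite ltr0n.
pose mu (x : pt R n) k := (homog x *m invmx A) ord0 k.
have muE x : homog x = \sum_k mu x k *: homog (e (f k)).
  rewrite -[LHS](mulmxKV uA) mulmx_sum_row; apply: eq_bigr => k _.
  by rewrite row_rowsub rowK.
have mu1 x : \sum_k mu x k = 1.
  have /rowP/(_ ord0) := muE x; rewrite mxE unlift_none summxE => ->.
  by apply: eq_bigr => k _; rewrite !mxE unlift_none mulr1.
have xE x : x = \sum_k mu x k *: e (f k).
  by apply: homog_inj; rewrite homog_sum ?mu1 // -muE.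
pose o := \sum_k n.+1%:R^-1 *: e (f k).
have n1 : \sum_(k < n.+1) n.+1%:R^-1 = 1 :> R.
  by rewrite sumr_const card_ord -[LHS]mulr_natl mulfV ?gt_eqF.
have muo k : mu o k = n.+1%:R^-1.
  rewrite /mu /o homog_sum //.
  have -> : \sum_k0 n.+1%:R^-1 *: homog (e (f k0)) = const_mx n.+1%:R^-1 *m A.
    by rewrite mulmx_sum_row; apply: eq_bigr => l _; rewrite row_rowsub rowK mxE.
  by rewrite mulmxK // mxE.
case: (noint o).
pose w k j := invmx A j k.
have muD x k : mu x k = w k ord0 + dot (\row_i w k (lift ord0 i)) x.
  by rewrite -sum_homog /mu mxE.
have [|d d0 dP] := @near_dot R n _ (enum 'I_n.+1) (fun k => \row_i w k (lift ord0 i)) (fun k => - w k ord0) o.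
  by move=> k _; rewrite -subr_gt0 opprK addrC -muD muo invr_gt0.
exists d => // y yd; rewrite (xE y).
pose m k := Num.max 0 (mu y k).
have mE k : m k = mu y k.
  apply/max_idPr/ltW; rewrite muD.
  by have := dP y yd k; rewrite mem_enum => /(_ isT); lra.
under eq_bigr => k _ do rewrite -mE.
apply: conv_sum => [k||k]; first by rewrite le_max lexx.
  by rewrite -[RHS](mu1 y); apply: eq_bigr => k _; rewrite mE.
exact: conv_vertex.
Qed.
End Hull.

(** * Supporting hyperplanes and boundaries of hulls *)

Section Normals.
Variables (R : realType) (n : nat) (I : choiceType).
Implicit Types (q p : I -> pt R n) (T : seq {fset I}) (s t : {fset I}) (a b : I -> R).

(** The form equal to 1 on every generator of [s]: its level 1 is the hyperplane spanned by the
    face. *)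
Definition normal (lam : {fset I} -> I -> pt R n) s : pt R n := \sum_(i <- s) lam s i.

Lemma normal_comb q lam s a : dual q s (lam s) ->
  dot (normal lam s) (comb q s a) = \sum_(i <- s) a i.
Proof.
move=> d; rewrite /normal dot_suml !big_seq; apply: eq_bigr => i is_.
exact: (dual_comb _ d).
Qed.

Lemma normal_vertex q lam s i : dual q s (lam s) -> i \in s ->
  dot (normal lam s) (q i) = 1.
Proof. by move=> d is_; rewrite -(comb_delta q is_) (normal_comb _ d) sum_delta1. Qed.

Definition all_vertices T : {fset I} := [fset i in flatten [seq enum_fset t | t <- T]].

Lemma all_verticesP T i : reflect (exists2 t, t \in T & i \in t) (i \in all_vertices T).
Proof. by rewrite !inE; apply: flatten_mapP. Qed.

Section Polytope.
Variables (q : I -> pt R n) (T : seq {fset I}) (lam : {fset I} -> I -> pt R n).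
Hypothesis fanT : fan q T.
Hypothesis dualT : forall s, s \in T -> dual q s (lam s).
Hypothesis completeT : complete q T.
Hypothesis nonemptyT : forall s, s \in T -> s != fset0.
Hypothesis support : forall s t i, s \in T -> t \in T -> i \in t -> dot (normal lam s) (q i) <= 1.

Let F := q @` all_vertices T.

Let injF : {in all_vertices T &, injective q}.
Proof.
by move=> i j /all_verticesP[s sT is_] /all_verticesP[t tT jt]; apply: (fan_inj fanT sT tT).
Qed.

Let subV t : t \in T -> t `<=` all_vertices T.
Proof. by move=> tT; apply/fsubsetP => i it; apply/all_verticesP; exists t. Qed.

Lemma hull_halfspaces x : conv F x <-> forall s, s \in T -> dot (normal lam s) x <= 1.
Proof.
split=> [/(conv_image _ injF)[a [[a0 _] a1 ->]] s sT|hx].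
  rewrite dot_comb -a1 !big_seq; apply: ler_sum => i /all_verticesP[t tT it].
  by rewrite ler_piMr // (support sT tT it).
apply/(conv_image _ injF).
have [s [_ [sT _ _]]] := completeT 0.
have [t [b [tT cb bE]]] := completeT (- comb q s (fun=> 1)).
have c1 : coef s (restr s (fun=> 1) : I -> R) by apply: coef_restr.
pose V := all_vertices T.
(* A nonnegative relation, made of the generators of [s] and a representation of the negative of
   their sum. It fills the total up to 1 without moving the point. *)
pose z i := restr s (fun=> 1) i + b i.
have cz : coef V z by apply: coefD; [apply: coefS c1|apply: coefS cb]; exact: subV.
have z0 : comb q V z = 0.
  rewrite combD -(comb_widen q (subV sT) c1.2) -(comb_widen q (subV tT) cb.2) comb_restr -bE.
  by rewrite subrr.
have N0 : 0 < \sum_(i <- V) z i.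
  rewrite big_split /= -(sum_widen (subV sT) c1.2) sum_restr ltr_pwDl //; last first.
    by apply: sumr_ge0 => i _; case: cb.
  by rewrite big_const_seq count_predT iter_addr_0 ltr0n cardfs_gt0 nonemptyT.
have [u [a [uT ca xE]]] := completeT x.
have a1 : \sum_(i <- u) a i <= 1 by rewrite -(normal_comb a (dualT uT)) -xE hx.
pose r := (1 - \sum_(i <- u) a i) / \sum_(i <- V) z i.
exists (fun i => a i + r * z i); split.
- apply: coefD; first exact: coefS (subV uT) ca.
  by apply: coefZ => //; rewrite divr_ge0 ?subr_ge0 // ltW.
- by rewrite big_split -mulr_sumr /= divfK ?lt0r_neq0 // -(sum_widen (subV uT) ca.2) addrC subrK.
- by rewrite combD combZ z0 scaler0 addr0 -(comb_widen q (subV uT) ca.2).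
Qed.

(** At a boundary point some inequality is tight; as all vertices satisfy it, the coefficient total
    in the cone containing the point is 1. *)
Lemma fan_boundary : carrier (geom_image q T) = boundary_pt (conv F).
Proof.
have eT := fan_embedded fanT.
apply/seteqP; split=> x; rewrite carrier_image //.
  move=> [s [a [sT ca a1 xE]]]; have x1 : dot (normal lam s) x = 1.
    by rewrite xE (normal_comb a (dualT sT)).
  split.
    apply: closure_conv; apply/hull_halfspaces => t tT.
    rewrite xE dot_comb -a1 !big_seq; apply: ler_sum => i is_.
    by rewrite ler_piMr ?(support tT sT is_) //; case: ca.
  move=> [d d0 dP]; have [e e0 he] := near_dir x x d0.
  have /hull_halfspaces/(_ s sT) := dP _ (he e (ltW e0) (lexx _)).
  by rewrite dotDr dotZr x1; lra.
move=> [cx nx].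
have le1 t : t \in T -> dot (normal lam t) x <= 1.
  move=> tT; rewrite leNgt; apply/negP => gt.
  have [|d d0 dP] := @near_dot R n _ [:: t] (normal lam) (fun=> 1) x.
    by move=> t'; rewrite inE => /eqP ->.
  have [y Fy xy] := cx d d0.
  have /hull_halfspaces/(_ t tT) := Fy.
  by rewrite leNgt dP ?inE.
have [s sT s1] : exists2 s, s \in T & 1 <= dot (normal lam s) x.
  apply: contrapT => no; apply: nx.
  have [|d d0 dP] := @near_dot R n _ T (fun s => - normal lam s) (fun=> -1) x.
    move=> t tT; rewrite dotNl ltrN2 ltNge; apply/negP => ge; apply: no.
    by exists t.
  exists d => // y xy; apply/hull_halfspaces => t tT.
  by have := dP y xy t tT; rewrite dotNl ltrN2 => /ltW.
have [t [a [tT ca xE]]] := completeT x.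
exists t, a; split=> //; apply/eqP; rewrite eq_le.
rewrite -{1}(normal_comb a (dualT tT)) -xE le1 //=; apply: le_trans s1 _.
rewrite xE dot_comb !big_seq; apply: ler_sum => i it.
by rewrite ler_piMr ?(support sT tT it) //; case: ca.
Qed.

Lemma hull_nonempty : F != fset0.
Proof.
have [s [_ [sT _ _]]] := completeT 0.
have /fset0Pn[i is_] := nonemptyT sT.
by apply/fset0Pn; exists (q i); apply/in_imfset/all_verticesP; exists s.
Qed.
End Polytope.

Section Boundary.
Variables (p : I -> pt R n) (T : seq {fset I}) (o : pt R n).
Hypothesis embT : embedded p T.
Let q i := p i - o.

Lemma affine_comb s a : \sum_(i <- s) a i = 1 -> comb p s a = o + comb q s a.
Proof.
move=> a1; rewrite /comb /q; under [in RHS]eq_bigr => i _ do rewrite scalerBr.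
by rewrite sumrB -scaler_suml a1 scale1r addrC subrK.
Qed.

Lemma coef_sum0 s a : coef s a -> \sum_(i <- s) a i = 0 -> forall i, a i = 0.
Proof.
move=> [a0 as_] /eqP; rewrite psumr_eq0 // => /allP h i.
by have [/h/eqP|/as_] := boolP (i \in s).
Qed.

(** Equal totals allow both representations to be normalised to convex ones. The totals agree in the
    solid case by [boundary_ray], in the flat case because the hyperplane form reads them off. *)
Lemma embedded_fan :
  (forall s t a b, s \in T -> t \in T -> coef s a -> coef t b -> comb q s a = comb q t b ->
     \sum_(i <- s) a i = \sum_(i <- t) b i) -> fan q T.
Proof.
move=> h s t a b sT tT ca cb ab.
have e := h _ _ _ _ sT tT ca cb ab; set r := \sum_(i <- s) a i in e *.
have r0 : 0 <= r by apply: sumr_ge0 => i _; case: ca.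
have [rz|rn] := eqVneq r 0.
  by move=> i; rewrite (coef_sum0 ca rz) (coef_sum0 cb) // -e.
have ri : 0 <= r^-1 by rewrite invr_ge0.
have a1 : \sum_(i <- s) r^-1 * a i = 1 by rewrite -mulr_sumr mulVf.
have b1 : \sum_(i <- t) r^-1 * b i = 1 by rewrite -mulr_sumr -e mulVf.
have := embT sT tT (coefZ ri ca) (coefZ ri cb) a1 b1.
rewrite !affine_comb // !combZ ab => /(_ erefl) h1 i.
by apply: (mulfI _ (h1 i)); rewrite invr_eq0.
Qed.

Variable F : {fset pt R n}.
Hypothesis bdT : carrier (geom_image p T) = boundary_pt (conv F).

Lemma boundary_comb s a : s \in T -> coef s a -> \sum_(i <- s) a i = 1 ->
  boundary_pt (conv F) (comb p s a).
Proof. by move=> sT ca a1; rewrite -bdT; apply/(carrier_image _ embT); exists s, a. Qed.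

Section Solid.
Hypothesis oi : interior_pt (conv F) o.

Let not_zero t b : t \in T -> coef t b -> comb q t b = 0 -> \sum_(i <- t) b i = 0.
Proof.
move=> tT cb b0; apply/eqP; apply: contraT => bn.
have bi : 0 <= (\sum_(i <- t) b i)^-1.
  by rewrite invr_ge0; apply: sumr_ge0 => i _; case: cb.
have [] := boundary_comb tT (coefZ bi cb); first by rewrite -mulr_sumr mulVf.
by rewrite affine_comb -?mulr_sumr ?mulVf // combZ b0 scaler0 addr0.
Qed.

Lemma solid_fan : fan q T.
Proof.
apply: embedded_fan => s t a b sT tT ca cb ab.
have a0 : 0 <= \sum_(i <- s) a i by apply: sumr_ge0 => i _; case: ca.
have b0 : 0 <= \sum_(i <- t) b i by apply: sumr_ge0 => i _; case: cb.
have zero u c : coef u c -> \sum_(i <- u) c i = 0 -> comb q u c = 0.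
  move=> cu c0; rewrite /comb big1 // => i _.
  by rewrite (coef_sum0 cu c0) scale0r.
have [az|an] := eqVneq (\sum_(i <- s) a i) 0.
  by rewrite az (not_zero tT cb) // -ab zero.
have [bz|bn] := eqVneq (\sum_(i <- t) b i) 0.
  by rewrite bz (not_zero sT ca) // ab zero.
have ap : 0 < \sum_(i <- s) a i by rewrite lt_def an.
have bp : 0 < \sum_(i <- t) b i by rewrite lt_def bn.
set u := \sum_(i <- s) a i in an ap a0 *; set w := \sum_(i <- t) b i in bn bp b0 *.
have a1 : \sum_(i <- s) u^-1 * a i = 1 by rewrite -mulr_sumr mulVf.
have b1 : \sum_(i <- t) w^-1 * b i = 1 by rewrite -mulr_sumr mulVf.
have ui : 0 <= u^-1 by rewrite invr_ge0 ltW.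
have wi : 0 <= w^-1 by rewrite invr_ge0 ltW.
have := boundary_ray (t := u / w) oi _ (boundary_comb sT (coefZ ui ca) a1) (boundary_comb tT (coefZ wi cb) b1).
rewrite !affine_comb // ![o + _]addrC !addrK !combZ ab scalerA => h.
have : u / w = 1 by apply: h; [rewrite divr_gt0|congr (_ *: _); rewrite mulrAC divff ?mul1r].
by move/(congr1 (fun r => r * w)); rewrite divfK // mul1r.
Qed.

Lemma solid_complete : T != [::] -> complete q T.
Proof.
move=> T0 x; have [->|x0] := eqVneq x 0.
  case: T T0 => // t T' _; exists t, (fun=> 0); rewrite mem_head; split=> //.
  by rewrite /comb big1 // => i _; rewrite scale0r.
have [r r0] := ray_boundary oi x0; rewrite -bdT => /(carrier_image _ embT)[t [a [tT ca a1]]].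
rewrite affine_comb // => /addrI rx.
exists t, (fun i => r^-1 * a i); split=> //; first by apply: coefZ; rewrite ?invr_ge0 // ltW.
by rewrite combZ -rx scalerA mulVf ?scale1r // lt0r_neq0.
Qed.

Lemma solid_support (lam : {fset I} -> I -> pt R n) s t j :
  s != fset0 -> dual q s (lam s) -> s \in T -> t \in T -> j \in t ->
  dot (normal lam s) (q j) <= 1.
Proof.
move=> s0 ds sT tT jt; rewrite leNgt; apply/negP => gt.
have js : j \notin s.
  by apply: contraTN gt => js; rewrite (normal_vertex ds js) ltxx.
set g := dot _ _ in gt.
pose N := #|` s|%:R : R.
have N0 : 0 < N by rewrite ltr0n cardfs_gt0.
pose L := \sum_(k <- s) `|dot (lam s k) (q j)| + 1.
have L0 : 0 < L by rewrite ltr_wpDl // sumr_ge0.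
(* Since [N^-1 = e * L] dominates [e * dot (lam s k) (q j)], the weights [b] below are nonnegative;
   [d] is the value for which they sum to [1 - e]. *)
pose e := (N * L)^-1.
have e0 : 0 < e by rewrite invr_gt0 mulr_gt0.
pose d := e * (g - 1).
have d0 : 0 < d by rewrite mulr_gt0 // subr_gt0.
(* [e] times [q j] plus the combination [b] is [1 + d] times the centroid of [s],
   with total weight one: the centroid would be interior. *)
pose b k := (1 + d) / N - e * dot (lam s k) (q j).
have b0 k : k \in s -> 0 <= b k.
  move=> ks; rewrite /b mulrDl mul1r.
  have : 0 <= d / N by rewrite divr_ge0 // ltW.
  have -> : N^-1 = e * L by rewrite /e invfM divfK ?gt_eqF.
  have : dot (lam s k) (q j) <= L.
    apply: le_trans (ler_norm _) _; rewrite /L (big_fsetD1 k) //= -addrA lerDl.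
    by rewrite addr_ge0 // sumr_ge0.
  move=> h1; have : e * dot (lam s k) (q j) <= e * L by rewrite ler_wpM2l // ltW.
  lra.
have sb : \sum_(k <- s) b k = 1 - e.
  rewrite /b sumrB big_const_seq count_predT iter_addr_0 -mulr_sumr.
  have -> : \sum_(k <- s) dot (lam s k) (q j) = g by rewrite /g /normal dot_suml.
  rewrite -[_ *+ _]mulr_natr -/N divfK ?gt_eqF // /d; ring.
pose a k := if k == j then e else restr s b k.
have aE k : k \in s -> a k = b k.
  by rewrite /a /restr => ks; rewrite ks; case: eqP js => // <-; rewrite ks.
have a0 k : 0 <= a k.
  by rewrite /a /restr; case: ifP => [_|_]; [exact: ltW|case: ifP => // /b0].
have a1 : \sum_(k <- j |` s) a k = 1.
  rewrite big_fsetU1 //= {1}/a eqxx.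
  have -> : \sum_(k <- s) a k = \sum_(k <- s) b k.
    by rewrite !big_seq; apply: eq_bigr => k /aE.
  by rewrite sb addrC subrK.
have cz : closure_pt (conv F) (comb p (j |` s) a).
  apply: closure_sum => // [k|]; last first.
    by have [x Fx _] := (boundary_comb tT (coef_delta R jt) (sum_delta1 R jt)).1 1 ltr01; exists x.
  have vc u i : u \in T -> i \in u -> closure_pt (conv F) (p i).
    by move=> uT iu; have [+ _] := boundary_comb uT (coef_delta R iu) (sum_delta1 R iu);
      rewrite comb_delta.
  have [->|kj] := eqVneq k j; first by right; apply: (vc t).
  have [ks|ks] := boolP (k \in s); first by right; apply: (vc s).
  by left; rewrite /a /restr (negbTE kj) (negbTE ks).
have c1 : coef s (restr s (fun=> N^-1)) by apply: coef_restr => k _; rewrite invr_ge0 ltW.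
have s1 : \sum_(k <- s) restr s (fun=> N^-1) k = 1.
  by rewrite sum_restr big_const_seq count_predT iter_addr_0 -[LHS]mulr_natl mulfV ?gt_eqF.
have [_] := boundary_comb sT c1 s1; apply.
have -> : comb p s (restr s (fun=> N^-1)) = o + (1 + d)^-1 *: (comb p (j |` s) a - o).
  rewrite !affine_comb // [o + comb q (j |` s) a]addrC addrK; congr (_ + _).
  have -> : comb q (j |` s) a = (1 + d) *: comb q s (fun=> N^-1).
    rewrite /comb big_fsetU1 //= {1}/a eqxx -/(comb q s a) (eq_comb q aE).
    rewrite [in e *: q j](ds.1 (q j)) -!combZ -/(comb q s _) -combD.
    by apply: eq_comb => k ks; rewrite /b addrC subrK.
  by rewrite comb_restr scalerA mulVf ?scale1r // lt0r_neq0 // addr_gt0.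
apply: interior_segment => //; first by rewrite invr_ge0 addr_ge0 // ltW.
by rewrite invf_lt1 ?addr_gt0 // ltrDl.
Qed.
End Solid.

Lemma flat_closure (a : pt R n) (r : R) : (forall x, x \in F -> dot a x = r) ->
  forall x, closure_pt (conv F) x -> dot a x = r.
Proof.
move=> hF x cx.
have hc y : conv F y -> dot a y = r.
  move=> [l [l0 [l1 ->]]]; rewrite dot_sumr -[RHS]mulr1 -l1 mulr_sumr !big_seq.
  by apply: eq_bigr => z zF; rewrite dotZr hF // mulrC.
apply/eqP; rewrite eq_le !leNgt; apply/andP; split; apply/negP => lt.
  have [|d d0 dP] := @near_dot R n _ [:: tt] (fun=> a) (fun=> r) x; first by [].
  have [y Fy xy] := cx d d0.
  by have := dP y xy tt (mem_head _ _); rewrite hc // ltxx.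
have [|d d0 dP] := @near_dot R n _ [:: tt] (fun=> - a) (fun=> - r) x.
  by move=> _ _; rewrite dotNl ltrN2.
have [y Fy xy] := cx d d0.
by have := dP y xy tt (mem_head _ _); rewrite dotNl hc // ltxx.
Qed.
End Boundary.

(** Were no ridge free, the walk in the fan over the flat complex would reach a cone containing
    [- a]; but [a] is nonnegative on every cone. *)
Lemma flat_free_ridge p T F : embedded p T -> carrier (geom_image p T) = boundary_pt (conv F) ->
  F != fset0 -> T != [::] -> (forall s, s \in T -> #|` s| = n) ->
  (forall o, ~ interior_pt (conv F) o) ->
  exists s i, [/\ s \in T, i \in s & forall t, t \in T -> s `\ i `<=` t -> t = s].
Proof.
move=> eT bd F0 T0 szT noint; apply: contrapT => nofree.
have [a [r [a0 aF]]] := flat_hull F0 noint.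
have aa : 0 < dot a a by rewrite dot_gt0.
(* With the viewpoint one level of [a] below the hyperplane, every vertex has height 1, so [a]
   computes coefficient totals. *)
pose o := ((r - 1) / dot a a) *: a.
have ao : dot a o = r - 1 by rewrite dotZr divfK ?gt_eqF.
pose q i := p i - o.
have aq t i : t \in T -> i \in t -> dot a (q i) = 1.
  move=> tT it; have [cp _] := boundary_comb eT bd tT (coef_delta R it) (sum_delta1 R it).
  rewrite comb_delta // in cp.
  by rewrite dotBr ao (flat_closure aF cp) opprB addrC subrK.
have ac t c : t \in T -> dot a (comb q t c) = \sum_(i <- t) c i.
  move=> tT; rewrite dot_comb !big_seq; apply: eq_bigr => i it.
  by rewrite (aq t) // mulr1.
have fT : fan q T.
  apply: (embedded_fan eT) => s t b c sT tT _ _ bc.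
  by rewrite -(ac s) // -/q -(ac t) //; congr (dot a _).
have /choice[lam lamP] : forall s, exists l, s \in T -> dual q s l.
  move=> s; have [sT|sT] := boolP (s \in T); last by exists (fun=> 0).
  by have [l ls] := dual_exists (szT s sT) (fan_free fT sT); exists l.
have walls : walls_shared q T lam.
  apply: (ridge_walls fT lamP szT) => s i sT is_; apply: contrapT => no; apply: nofree.
  exists s, i; split=> // t tT st; apply/eqP; apply: contraT => ts.
  by case: no; exists t.
case: T T0 lamP walls fT eT bd szT aq ac {nofree} => // s0 T' _ lamP walls fT eT bd szT aq ac.
have [t [tT _ xt]] := walk lamP walls (x := - a) (good := fun=> True) (mem_head s0 T') Logic.I (fun _ _ _ _ _ _ _ _ _ => Logic.I).
have := (lamP t tT).1 (- a) => xE.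
have : dot a (- a) < 0 by rewrite dotNr oppr_lt0.
by rewrite xE ac // ltNge big_seq sumr_ge0.
Qed.
End Normals.

(** * Stars, links and inversion *)

Section Manifold.
Variables (R : realType) (n : nat) (V : choiceType) (K : set {fset V}) (l : V -> V -> R).

Definition star_tops (v0 : V) (T : seq {fset V}) := [seq v0 |` t | t <- T].

Definition link_tops (v0 : V) (T : seq {fset V}) :=
  [/\ forall t, t \in T -> [/\ v0 \notin t, #|` t| = n & K (v0 |` t)], T != [::],
      vlink K v0 = subfaces T, vstar K v0 = subfaces (star_tops v0 T) &
      forall s, K s -> v0 \in s -> exists2 t, t \in T & s `<=` v0 |` t].

Lemma link_tops_exist v0 : tri_PE_manifold n K l -> vertices K v0 ->
  exists T, link_tops v0 T.
Proof.
move=> [[[K0 Ksub] Klf] Kpure Kdim _ _] Kv0.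
have /finite_seqP[S SE] := Klf v0.
have SP s : (s \in S) <-> K s /\ v0 \in s.
  by split=> [sS|ks]; [have : [set` S]%classic s by []|have : [set s | K s /\ v0 \in s]%classic s by []];
    rewrite -?SE // SE.
pose T := [seq s `\ v0 | s <- S & #|` s| == n.+1].
have TP t : t \in T -> [/\ v0 \notin t, #|` t| = n & K (v0 |` t)].
  move=> /mapP[s]; rewrite mem_filter => /andP[/eqP sn /SP[Ks v0s]] ->.
  rewrite !inE eqxx fsetD1K //; split=> //.
  by move: sn; rewrite (cardfsD1 v0 s) v0s => -[].
have topP s : K s -> v0 \in s -> exists2 t, t \in T & s `<=` v0 |` t.
  move=> Ks v0s; have [t [Kt [st tn]]] := Kpure s Ks.
  have v0t := fsubsetP st _ v0s.
  exists (t `\ v0); last by rewrite fsetD1K.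
  by apply: map_f; rewrite mem_filter tn eqxx /=; apply/SP.
exists T; split=> //.
- have [|t tT _] := topP _ Kv0; first by rewrite inE.
  by apply/eqP => T0; rewrite T0 in tT.
- apply/seteqP; split=> [s [[Ks [t [Kt [v0t st]]]] v0s]|s [s0 [t tT st]]].
    split; first exact: K0.
    have [u uT tu] := topP t Kt v0t; exists u => //.
    apply/fsubsetP => i is_; have := fsubsetP tu _ (fsubsetP st _ is_).
    by rewrite !inE => /orP[/eqP iv|//]; rewrite iv (negbTE v0s) in is_.
  have [v0t _ Kt] := TP t tT.
  have st' : s `<=` v0 |` t by apply: fsubset_trans st _; rewrite fsubsetUr.
  split; last by apply: contraNN v0t; exact: (fsubsetP st).
  split; first exact: Ksub Kt st' s0.
  by exists (v0 |` t); rewrite !inE eqxx.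
- apply/seteqP; split=> [s [Ks [t [Kt [v0t st]]]]|s [s0 [_ /mapP[t tT ->] st]]].
    split; first exact: K0.
    have [u uT tu] := topP t Kt v0t; exists (v0 |` u); first exact: map_f.
    exact: fsubset_trans tu.
  have [v0t _ Kt] := TP t tT.
  split; first exact: Ksub Kt st s0.
  by exists (v0 |` t); rewrite !inE eqxx.
Qed.

(** The function [l] is arbitrary a priori; positivity and symmetry come from the Euclidean
    realisation of a top simplex. *)
Lemma length_pos v0 T t a b : tri_PE_manifold n K l -> link_tops v0 T -> t \in T ->
  a \in v0 |` t -> b \in v0 |` t -> a != b -> 0 < l a b /\ l a b = l b a.
Proof.
move=> [_ _ _ Keuc _] [TP _ _ _ _] tT at_ bt ab.
have [v0t tn Kt] := TP t tT.
have [|q [aff qE]] := Keuc _ Kt; first by rewrite cardfsU1 v0t tn.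
rewrite -!qE // (edistC (q b)); split=> //.
rewrite edist_gt0; apply/eqP => qab.
have := aff (fun i => delta R a i - delta R b i) _ _ a at_.
rewrite sumrB !sum_delta1 // subrr => /(_ erefl) h.
suff : delta R a a - delta R b a = 0.
  by rewrite /delta eqxx (negbTE ab) subr0 => /eqP; rewrite oner_eq0.
apply: h; under eq_bigr => i _ do rewrite scalerBl.
by rewrite sumrB -!/(comb q _ _) !comb_delta // qab subrr.
Qed.

Lemma star_edge v0 T i : link_tops v0 T -> vertices (subfaces T) i ->
  [/\ vstar K v0 [fset v0; i], v0 != i & exists2 t, t \in T & i \in t].
Proof.
move=> [TP _ _ sE _] /subfaces_vertex[t tT it].
have [v0t _ _] := TP t tT; split; last by exists t.
  rewrite sE; split; first by apply/fset0Pn; exists v0; rewrite !inE eqxx.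
  exists (v0 |` t); first exact: map_f.
  by apply/fsubsetP => j; rewrite !inE => /orP[->//|/eqP ->]; rewrite it orbT.
by apply: contraNneq v0t => ->.
Qed.

End Manifold.

Section Inversion.
Variables (R : realType) (n : nat).
Implicit Types (x y : pt R n).

Lemma edist_sqr0 x : edist x 0 ^+ 2 = dot x x.
Proof. by rewrite edist_sqr subr0. Qed.

Lemma inversion_edist (e : R) x y : 0 <= e -> x != 0 -> y != 0 ->
  edist (e / dot x x *: x) (e / dot y y *: y) = e * edist x y / (edist x 0 * edist y 0).
Proof.
move=> e0 x0 y0.
have dx : dot x x != 0 by rewrite gt_eqF // dot_gt0.
have dy : dot y y != 0 by rewrite gt_eqF // dot_gt0.
apply/eqP; rewrite -(@eqrXn2 _ 2) ?edist_ge0 //; last first.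
  by rewrite divr_ge0 ?mulr_ge0 ?edist_ge0.
rewrite edist_sqr expr_div_n !exprMn edist_sqr !edist_sqr0.
rewrite !dotBl !dotBr !dotZl !dotZr (dotC y x).
by apply/eqP; field; rewrite dx dy.
Qed.

(* For the inverse [y = e x / |x|^2] of [x], the position of [x] relative to the
   sphere through the origin centred at [c] is that of [y] relative to the
   hyperplane [<(2/e) c, y> = 1]. *)
Lemma sphere_hyperplane (e : R) (c x y : pt R n) (m : pt R n) : 0 < e ->
  c = (e / 2) *: m -> x != 0 -> y = (e / dot x x) *: x ->
  edist c x ^+ 2 = dot c c + dot x x * (1 - dot m y).
Proof.
move=> e0 -> x0 ->.
have dx : dot x x != 0 by rewrite gt_eqF // dot_gt0.
rewrite edist_sqr dotBl !dotBr !dotZl !dotZr (dotC x m).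
by field.
Qed.
End Inversion.

(** * From a Delaunay star to supporting hyperplanes *)

Section Forward.
Variables (R : realType) (n : nat) (V : choiceType) (phi : V -> pt R n)
  (T : seq {fset V}) (v0 : V) (e : R).
Hypothesis e0 : 0 < e.
Hypothesis v0T : forall t, t \in T -> v0 \notin t.
Hypothesis sizeT : forall t, t \in T -> #|` t| = n.
Let star := star_tops v0 T.
Hypothesis embS : embedded phi star.
Let L := geom_image phi star.
Hypothesis interior0 : interior_pt (carrier L) (phi v0).
Hypothesis delaunay : locally_delaunay L.

Let rel i := phi i - phi v0.
Let q i := (e / dot (rel i) (rel i)) *: rel i.

Let fan_rel : fan rel T. Proof. exact: star_fan. Qed.
Let complete_rel : complete rel T. Proof. exact: star_interior_complete. Qed.

Lemma inverse_factor_gt0 t i : t \in T -> i \in t -> 0 < e / dot (rel i) (rel i).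
Proof. by move=> tT it; rewrite divr_gt0 // dot_gt0 (fan_neq0 fan_rel tT it). Qed.

Lemma inverse_fan : fan q T.
Proof. exact: fan_scale inverse_factor_gt0 fan_rel. Qed.

Lemma inverse_complete : complete q T.
Proof. exact: complete_scale inverse_factor_gt0 complete_rel. Qed.

Variable lam : {fset V} -> V -> pt R n.
Hypothesis dualT : forall s, s \in T -> dual q s (lam s).

Lemma top_in_image t : t \in T -> L (phi @` (v0 |` t)) /\ #|` phi @` (v0 |` t)| = n.+1.
Proof.
move=> tT; have vT : v0 |` t \in star by exact: map_f.
split.
  exists (v0 |` t) => //; split; last by exists (v0 |` t).
  by apply/fset0Pn; exists v0; rewrite !inE eqxx.
rewrite card_in_imfset /=; first by rewrite cardfsU1 v0T // sizeT.
exact: (embedded_inj_in embS vT).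
Qed.

Lemma delaunay_local s i t j : s \in T -> i \in s -> opposite q T lam s i t j ->
  dot (normal lam s) (q j) <= 1.
Proof.
move=> sT is_ [tT js tE _].
have [Ls sn] := top_in_image sT; have [Lt tn] := top_in_image tT.
have vs : v0 |` s \in star by exact: map_f.
have vt : v0 |` t \in star by exact: map_f.
have ij : i != j by apply: contraNneq js => <-.
have jt : j \in t by rewrite tE !inE eqxx.
have stE : (phi @` (v0 |` s)) `&` (phi @` (v0 |` t)) = phi @` (v0 |` (s `\ i)).
  apply/fsetP => p; rewrite inE; apply/andP/imfsetP => /= [[/imfsetP[a as_ ->] /imfsetP[b bt ab]]|[a as_ ->]].
    exists a => //; have ba := embedded_inj embS vs vt as_ bt ab.
    move: as_ bt; rewrite -ba tE !inE; case: eqP => //= _ as_.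
    by case: eqP as_ js => [->|_] // -> .
  move: as_; rewrite !inE => /orP[/eqP ->|/andP[ai as_]].
    by split; apply: in_imfset; rewrite /= !inE eqxx.
  by split; apply: in_imfset; rewrite /= ?tE !inE ?as_ ?ai ?orbT.
have stn : #|` (phi @` (v0 |` s)) `&` (phi @` (v0 |` t))| = n.
  rewrite stE card_in_imfset /=.
    rewrite cardfsU1 !inE (negbTE (v0T sT)) andbF /= -(sizeT sT) [in RHS](cardfsD1 i) is_.
    by [].
  move=> a b ha hb; apply: (embedded_inj embS vs vs).
    by move: ha; rewrite !inE => /orP[->|/andP[_ ->]] //; rewrite orbT.
  by move: hb; rewrite !inE => /orP[->|/andP[_ ->]] //; rewrite orbT.
pose c := (e / 2) *: normal lam s.
have cE k u : u \in T -> k \in u ->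
    edist (phi v0 + c) (phi k) ^+ 2 = dot c c + dot (rel k) (rel k) * (1 - dot (normal lam s) (q k)).
  move=> uT ku; rewrite -(sphere_hyperplane e0 (erefl c) (fan_neq0 fan_rel uT ku) (erefl (q k))).
  by congr (_ ^+ 2); rewrite /rel [in LHS]edist0 [in RHS]edist0 opprB addrA [c + _]addrC.
have c0 : edist (phi v0 + c) (phi v0) ^+ 2 = dot c c.
  by rewrite edist0 addrAC subrr add0r edist_sqr0.
have := delaunay Ls Lt sn tn stn (c := phi v0 + c) (r := edist (phi v0 + c) (phi v0)).
move=> /(_ _ (phi j)) h.
have {}h : ~ (edist (phi v0 + c) (phi j) < edist (phi v0 + c) (phi v0)).
  apply: h; last by apply: in_imfset; rewrite /= !inE jt orbT.
  move=> _ /imfsetP[k /= ks ->]; move: ks; rewrite !inE => /orP[/eqP -> //|ks].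
  apply/eqP; rewrite -(@eqrXn2 _ 2) ?edist_ge0 // (cE _ s) // c0.
  by rewrite (normal_vertex (dualT sT) ks) subrr mulr0 addr0.
move/negP: h; rewrite -leNgt -(@ler_pXn2r _ 2) ?nnegrE ?edist_ge0 // (cE j t) // c0.
by rewrite lerDl pmulr_rge0 ?dot_gt0 ?(fan_neq0 fan_rel tT jt) // subr_ge0.
Qed.

(** During a walk towards [q i] the value of the current normal at [q i] never decreases: the
    difference of two adjacent normals vanishes on the shared wall, and its sign is the local
    inequality. The last cone has [i] as a generator, where its normal is 1. *)
Lemma delaunay_support s0 t i : s0 \in T -> t \in T -> i \in t ->
  dot (normal lam s0) (q i) <= 1.
Proof.
move=> s0T tT it.
have walls := complete_walls inverse_fan dualT sizeT inverse_complete.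
have [|u [uT gu xu]] := walk dualT walls (x := q i)
    (good := fun t => dot (normal lam s0) (q i) <= dot (normal lam t) (q i)) s0T (lexx _).
  move=> s k u j sT gs ks opp xneg; apply: le_trans gs _.
  have [uT js uE neg] := opp.
  have ju : j \in u by rewrite uE !inE eqxx.
  pose d := normal lam u - normal lam s.
  have dE x : dot d x = dot (lam s k) x * dot d (q k).
    have [xE _] := dualT sT.
    rewrite [in LHS](xE x) dot_comb (big_fsetD1 k) //= big_seq big1 ?addr0 // => m.
    rewrite !inE => /andP[mk ms]; rewrite dotBl (normal_vertex (dualT sT) ms).
    by rewrite (normal_vertex (dualT uT)) ?subrr ?mulr0 // uE !inE mk ms orbT.
  rewrite -subr_ge0 -dotBl -/d dE nmulr_rge0 //.
  have := dE (q j); rewrite {1}/d dotBl (normal_vertex (dualT uT) ju) => h.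
  rewrite -(nmulr_rge0 _ neg) -h subr_ge0; exact: delaunay_local opp.
apply: le_trans gu _.
suff iu : i \in u by rewrite (normal_vertex (dualT uT) iu).
apply: contraT => iu.
have [xE _] := dualT uT.
have := inverse_fan tT uT (coef_delta R it) (coef_restr xu).
rewrite comb_restr -xE comb_delta // => /(_ erefl i).
by rewrite /delta /restr eqxx (negbTE iu) => /eqP; rewrite oner_eq0.
Qed.
End Forward.

(** * The equivalence at a single vertex *)

Section Equivalence.
Variables (R : realType) (n : nat) (V : choiceType) (K : set {fset V}) (l : V -> V -> R).
Hypothesis KM : tri_PE_manifold n K l.
Variables (v0 : V) (T : seq {fset V}).
Hypothesis topsT : link_tops n K v0 T.

Let TP t : t \in T -> [/\ v0 \notin t, #|` t| = n & K (v0 |` t)].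
Proof. by case: topsT => h _ _ _ _; apply: h. Qed.
Let v0T t : t \in T -> v0 \notin t. Proof. by case/TP. Qed.
Let sizeT t : t \in T -> #|` t| = n. Proof. by case/TP. Qed.
Let T0 : T != [::]. Proof. by case: topsT. Qed.
Let linkE : vlink K v0 = subfaces T. Proof. by case: topsT. Qed.
Let starE : vstar K v0 = subfaces (star_tops v0 T). Proof. by case: topsT. Qed.

Lemma dual_family (q : V -> pt R n) : fan q T ->
  exists lam, forall s, s \in T -> dual q s (lam s).
Proof.
move=> fT; have /boolp.choice[lam lamP] : forall s, exists m, s \in T -> dual q s m.
  move=> s; have [sT|sT] := boolP (s \in T); last by exists (fun=> 0).
  by have [m ms] := dual_exists (sizeT sT) (fan_free fT sT); exists m.
by exists lam.
Qed.

Let link_vertex a b : vlink K v0 [fset a; b] -> vertices (subfaces T) a /\ vertices (subfaces T) b.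
Proof.
rewrite linkE => -[_ [t tT ab]]; split; apply/subfaces_vertex; exists t => //;
  by apply: (fsubsetP ab); rewrite !inE eqxx ?orbT.
Qed.

Let link_star a b : vlink K v0 [fset a; b] -> vstar K v0 [fset a; b].
Proof. by case. Qed.

Lemma flat_star_polytope (L : set {fset pt R n}) : (0 < n)%N -> discrete_domain L -> locally_delaunay L ->
  disc_conf_equiv (vstar K v0) l L -> link_polytope_cond n K l v0.
Proof.
move=> n0 [gL pL intL _] dL [phi [u [iso phiE]]].
rewrite starE in iso.
have LE := iso_image gL iso; have eS := iso_embedded gL iso.
have vS t : t \in T -> v0 |` t \in star_tops v0 T by apply: map_f.
(* Each top simplex has an interior vertex, and only [v0] can be interior to the star. *)
have int0 : interior_pt (carrier L) (phi v0).
  have [t tT] : exists t, t \in T by case: (T) T0 => // t T' _; exists t; rewrite mem_head.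
  have [Lt tn] := top_in_image v0T sizeT eS tT; rewrite -LE in Lt.
  have [_ /imfsetP[i /= it ->]] := intL _ Lt tn.
  by rewrite LE => ii; rewrite -{2}(star_interior_apex eS tT it ii).
move: dL int0; rewrite LE => dL int0.
(* With this squared radius the factor of an edge of the link becomes the product of the factors of
   the two edges to [v0], so all conformal factors cancel. *)
pose e := expR (u v0); have e0 : 0 < e by exact: expR_gt0.
pose rel i := phi i - phi v0.
pose q i := (e / dot (rel i) (rel i)) *: rel i.
have fq : fan q T := inverse_fan e0 v0T eS.
have cq : complete q T := inverse_complete e0 v0T eS int0.
have [lam lamP] := dual_family fq.
have sup := delaunay_support e0 v0T sizeT eS int0 dL lamP.
have ne s : s \in T -> s != fset0 by move=> sT; rewrite -cardfs_gt0 sizeT.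
have eq := fan_embedded fq.
exists (q @` all_vertices T), (geom_image q T), q; split.
- exact: hull_nonempty cq ne.
- exact: embedded_geom.
- rewrite linkE; exact: embedded_iso.
- exact: fan_boundary fq lamP cq ne sup.
move=> a b ab anb; have [va vb] := link_vertex ab.
have [sa v0a [s sT as_]] := star_edge topsT va.
have [sb v0b [t tT bt]] := star_edge topsT vb.
have frel := star_fan v0T eS.
have ra := fan_neq0 frel sT as_; have rb := fan_neq0 frel tT bt.
rewrite /q inversion_edist ?(ltW e0) // -!edist0 !(edistC _ (phi v0)).
have -> : edist (rel a) (rel b) = edist (phi a) (phi b) by rewrite /rel edist_addr.
have inS t' i : i \in t' -> i \in v0 |` t' by move=> it; rewrite !inE it orbT.
have v0S t' : v0 \in v0 |` t' by rewrite !inE eqxx.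
have [la _] := length_pos KM topsT sT (v0S s) (inS _ _ as_) v0a.
have [lb _] := length_pos KM topsT tT (v0S t) (inS _ _ bt) v0b.
rewrite (phiE _ _ (link_star ab) anb) (phiE _ _ sa v0a) (phiE _ _ sb v0b) mulrA.
have -> : e * expR ((u a + u b) / 2) = expR ((u v0 + u a) / 2) * expR ((u v0 + u b) / 2).
  by rewrite -!expRD; congr expR; field.
by field; rewrite !gt_eqF ?expR_gt0.
Qed.

Lemma polytope_flat_star : interior_vertex R n K v0 -> link_polytope_cond n K l v0 ->
  exists L, [/\ discrete_domain L, locally_delaunay L & disc_conf_equiv (n := n) (vstar K v0) l L].
Proof.
move=> [_ chart0] [F [L [p [F0 gL iso bd pE]]]].
rewrite linkE in iso.
have LE := iso_image gL iso; have eT := iso_embedded gL iso; rewrite {}LE {gL iso} in bd.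
have [[o oi]|noint] := pselect (exists o, interior_pt (conv F) o); last first.
  (* A free ridge of the flat link, joined with [v0], is a free facet at an interior vertex. *)
  exfalso.
  have [|s [i [sT is_ fr]]] := flat_free_ridge eT bd F0 T0 sizeT.
    by move=> o oi; apply: noint; exists o.
  have iv0 : i != v0 by apply: contraNneq (v0T sT) => <-.
  apply: (free_facet_no_chart (tau := v0 |` (s `\ i)) (i := i) _ _ _ _ chart0).
  - by rewrite !inE eqxx.
  - by rewrite !inE eqxx /= orbF.
  - by rewrite fsetUCA fsetD1K //; case: (TP sT).
  move=> r Kr tr; case: topsT => _ _ _ _ top.
  have v0r : v0 \in r by apply: (fsubsetP tr); rewrite !inE eqxx.
  have [t tT rt] := top r Kr v0r.
  suff ts : t = s by rewrite fsetUCA fsetD1K // -ts.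
  apply: fr => //; apply/fsubsetP => k ks.
  have := fsubsetP rt _ (fsubsetP tr k _); rewrite !inE; move: ks; rewrite !inE => /andP[ki ks].
  rewrite ki ks orbT => /(_ isT) /orP[/eqP kv|//].
  by have := v0T sT; rewrite -kv ks.
pose q i := p i - o.
have fq : fan q T := solid_fan eT bd oi.
have cq : complete q T := solid_complete eT bd oi T0.
have [lam lamP] := dual_family fq.
have sup s t j : s \in T -> t \in T -> j \in t -> dot (normal lam s) (q j) <= 1.
  move=> sT tT jt; apply: (solid_support eT bd oi _ (lamP _ sT) sT tT jt).
  by rewrite -cardfs_gt0 sizeT // -(sizeT tT) cardfs_gt0; apply/fset0Pn; exists j.
(* Unit inversion about [o]; the value 0 at [v0] places the apex at the origin. *)
pose k i := if i == v0 then 0 else 1 / dot (q i) (q i).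
have kE t i : t \in T -> i \in t -> k i = 1 / dot (q i) (q i).
  by move=> tT it; rewrite /k; case: eqP it => // ->; rewrite (negbTE (v0T tT)).
have k0 t i : t \in T -> i \in t -> 0 < k i.
  by move=> tT it; rewrite (kE t) // divr_gt0 // dot_gt0 (fan_neq0 fq tT it).
pose phi i := k i *: q i.
have phi0 : phi v0 = 0 by rewrite /phi /k eqxx scale0r.
have relE : (fun i => phi i - phi v0) = phi by apply/funext => i; rewrite phi0 subr0.
have fphi : fan (fun i => phi i - phi v0) T by rewrite relE; exact: fan_scale k0 fq.
have cphi : complete (fun i => phi i - phi v0) T by rewrite relE; exact: complete_scale k0 cq.
have eS := fan_star v0T fphi.
have [mu muP] := dual_family fphi.
have int0 := complete_star_interior v0T fphi muP cphi.
have vS t : t \in T -> v0 |` t \in star_tops v0 T by apply: map_f.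
have injS t : t \in T -> {in v0 |` t &, injective phi}.
  by move=> tT; apply: (embedded_inj_in eS (vS t tT)).
have topn t : t \in T -> #|` v0 |` t| = n.+1.
  by move=> tT; rewrite cardfsU1 v0T // sizeT.
have topL t : t \in T -> geom_image phi (star_tops v0 T) (phi @` (v0 |` t)).
  move=> tT; exists (v0 |` t) => //; split; last by exists (v0 |` t) => //; apply: vS.
  by apply/fset0Pn; exists v0; rewrite !inE eqxx.
have faceP s : geom_image phi (star_tops v0 T) s -> #|` s| = n.+1 ->
    exists2 t, t \in T & s = phi @` (v0 |` t).
  move=> [r [r0 [_ /mapP[t tT ->] rt]] <-] rn; exists t => //.
  suff -> : r = v0 |` t by [].
  apply/eqP; rewrite eqEfcard rt /= topn // -rn card_in_imfset //.
  by move=> i j ir jr; apply: (injS t tT); apply: (fsubsetP rt).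
have vertP a : vertices (geom_image phi (star_tops v0 T)) a ->
    interior_pt (carrier (geom_image phi (star_tops v0 T))) a -> a = phi v0.
  move=> [r [r0 [_ /mapP[t tT ->] rt]] ra].
  have /imfsetP[i ir ->] : a \in phi @` r by rewrite ra inE.
  by move=> /(star_interior_apex eS tT (fsubsetP rt _ ir)) ->.
exists (geom_image phi (star_tops v0 T)); split.
- split.
  + exact: embedded_geom.
  + move=> _ [s [s0 [_ /mapP[t tT ->] st]] <-].
    exists (phi @` (v0 |` t)); split; first exact: topL.
    by split; [apply: subset_imfset; exact/fsubsetP|rewrite card_in_imfset //=; [exact: topn|exact: injS]].
  + move=> s Ls sn; have [t tT ->] := faceP s Ls sn.
    by exists (phi v0) => //; apply: in_imfset; rewrite /= !inE eqxx.
  + move=> a b va ia vb ib; exists 0%N, (fun=> a).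
    by split=> //; rewrite (vertP a va ia) (vertP b vb ib).
(* Support holds for any two facets, so the open circumball of each simplex misses every vertex of
   the star. *)
- move=> s t Ls Lt sn tn _ c r cs w wt.
  have [s' sT sE] := faceP s Ls sn; have [t' tT tE] := faceP t Lt tn.
  move: wt; rewrite tE => /imfsetP[j /= jt ->]; move: jt; rewrite !inE => /orP[/eqP ->|jt].
    by rewrite cs ?ltxx // sE; apply: in_imfset; rewrite /= !inE eqxx.
  have cr : edist c 0 = r.
    by rewrite -phi0; apply: cs; rewrite sE; apply: in_imfset; rewrite /= !inE eqxx.
  have q0 u i : u \in T -> i \in u -> q i != 0 by exact: fan_neq0 fq.
  have phiE u i : u \in T -> i \in u ->
      edist c (phi i) ^+ 2 = dot c c + k i * (1 - 2 * dot c (q i)).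
    move=> uT iu; have := q0 u i uT iu; rewrite /phi (kE u) //; move: (q i) => y y0.
    rewrite edist_sqr dotBl !dotBr !dotZl !dotZr (dotC y c).
    by field; rewrite lt0r_neq0 // dot_gt0.
  (* A sphere through the origin centred at [c] inverts to the level 1 of the form [2 * dot c]; here
     this is the hyperplane of the facet [s']. *)
  have c1 i : i \in s' -> 2 * dot c (q i) = 1.
    move=> is_; have := cs (phi i); rewrite sE => /(_ _)/(congr1 (fun x => x ^+ 2)).
    rewrite (phiE s') // -cr edist_sqr0 => h.
    have /eqP : k i * (1 - 2 * dot c (q i)) = 0.
      apply: (addrI (dot c c)); rewrite addr0; apply: h.
      by apply: in_imfset; rewrite /= !inE is_ orbT.
    by rewrite mulf_eq0 gt_eqF ?(k0 s') //= subr_eq0 => /eqP.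
  have cN : 2 * dot c (q j) = dot (normal lam s') (q j).
    rewrite ((lamP s' sT).1 (q j)) (normal_comb _ (lamP s' sT)) dot_comb mulr_sumr !big_seq.
    by apply: eq_bigr => i is_; rewrite mulrCA c1 // mulr1.
  apply/negP; rewrite -leNgt -cr -(@ler_pXn2r _ 2) ?nnegrE ?edist_ge0 //.
  rewrite (phiE t') // edist_sqr0 lerDl mulr_ge0 ?(ltW (k0 _ _ tT jt)) //.
  by rewrite subr_ge0 cN (sup s' t').
(* Forced by the edges at [v0] once [u v0 = 0]: the norm of [phi i] is the inverse of that of [q i],
   and must equal [expR (u i / 2) * l v0 i]. *)
pose u i := if i == v0 then 0 else - (2 * ln (l v0 i * edist (q i) 0)).
exists phi, u; split; first by rewrite starE; exact: embedded_iso.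
pose N i := edist (q i) 0.
have N0 t i : t \in T -> i \in t -> 0 < N i.
  by move=> tT it; rewrite /N edist_gt0 (fan_neq0 fq tT it).
have inS t i : i \in t -> i \in v0 |` t by move=> it; rewrite !inE it orbT.
have v0S t : v0 \in v0 |` t by rewrite !inE eqxx.
have nv0 t i : t \in T -> i \in t -> v0 != i.
  by move=> tT it; apply: contraNneq (v0T tT) => ->.
have lpos t i : t \in T -> i \in t -> 0 < l v0 i /\ l v0 i = l i v0.
  move=> tT it; exact: length_pos KM topsT tT (v0S t) (inS t i it) (nv0 t i tT it).
have ue t i : t \in T -> i \in t -> expR (u i / 2) = (l v0 i * N i)^-1.
  move=> tT it; rewrite /u eq_sym (negbTE (nv0 t i tT it)) -/(N i).
  have -> : - (2 * ln (l v0 i * N i)) / 2 = - ln (l v0 i * N i) by field.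
  by rewrite expRN lnK // posrE mulr_gt0 ?(N0 t) //; case: (lpos t i tT it).
have uD a b : expR ((u a + u b) / 2) = expR (u a / 2) * expR (u b / 2).
  by rewrite mulrDl expRD.
have u0 : expR (u v0 / 2) = 1 by rewrite /u eqxx mul0r expR0.
have apex t i : t \in T -> i \in t ->
    edist (phi v0) (phi i) = expR ((u v0 + u i) / 2) * l v0 i.
  move=> tT it; rewrite uD u0 mul1r (ue t) // phi0 edistC normZ ?(ltW (k0 t i tT it)) //.
  rewrite (kE t) // -edist_sqr0 -/(N i).
  have := N0 t i tT it; have [l0 _] := lpos t i tT it.
  by move=> Ni; field; rewrite !gt_eqF.
move=> a b; rewrite starE => -[_ [_ /mapP[t tT ->] ab]] anb.
have : a \in v0 |` t by apply: (fsubsetP ab); rewrite !inE eqxx.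
have : b \in v0 |` t by apply: (fsubsetP ab); rewrite !inE eqxx orbT.
have [av|av] := eqVneq a v0.
  rewrite av in anb *; rewrite !inE eq_sym (negbTE anb) /= => bt _; exact: apex bt.
have [bv|bv] := eqVneq b v0.
  rewrite bv !inE (negbTE av) /= => _ at_.
  by rewrite edistC (apex t) // [u a + _]addrC; have [_ ->] := lpos t a tT at_.
rewrite !inE (negbTE av) (negbTE bv) /= => bt at_.
have kab : vlink K v0 [fset a; b].
  rewrite linkE; split; first by apply/fset0Pn; exists a; rewrite !inE eqxx.
  by exists t => //; apply/fsubsetP => i; rewrite !inE => /orP[] /eqP ->.
rewrite uD !(ue t) // /phi !(kE t) //.
rewrite inversion_edist ?ler01 ?(fan_neq0 fq tT at_) ?(fan_neq0 fq tT bt) //.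
rewrite edist_addr pE // -/(N a) -/(N b) mul1r.
have := N0 t a tT at_; have := N0 t b tT bt.
have [la _] := lpos t a tT at_; have [lb _] := lpos t b tT bt.
by move=> Nb Na; field; rewrite !gt_eqF.
Qed.

(** For [n = 0] the link is empty, and a point of the zero-dimensional space is a polytope with
    empty boundary. *)
Lemma flat_star_link (L : set {fset pt R n}) : discrete_domain L -> locally_delaunay L ->
  disc_conf_equiv (vstar K v0) l L -> link_polytope_cond n K l v0.
Proof.
move=> dL delL eL.
have [n0|n0] := posnP n; last exact: flat_star_polytope n0 dL delL eL.
have nolink s : ~ vlink K v0 s.
  rewrite linkE => -[s0 [t tT st]]; have /cardfs0_eq t0 : #|` t| = 0%N by rewrite sizeT.
  by rewrite t0 fsubset0 (negbTE s0) in st.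
have one (x y : pt R n) : x = y by apply/rowP => i; have := ltn_ord i; rewrite [X in (_ < X)%N]n0.
exists [fset 0], set0, (fun=> 0); split.
- by apply/fset0Pn; exists 0; rewrite inE.
- split=> // x.
  by exists 1 => //; apply: sub_finite_set (finite_set0 _) => s [].
- split=> [a b /nolink//|a /nolink//|p [] |S _]; by split=> [/nolink|].
- apply/seteqP; split=> [x [s []]|x [_ []]].
  by exists 1 => // y _; rewrite (one y 0); apply: conv_vertex; rewrite inE.
- by move=> a b /nolink.
Qed.
End Equivalence.

Theorem theorem2 (R : realType) (n : nat) (V : choiceType)
    (K : set {fset V}) (l : V -> V -> R) :
  tri_PE_manifold n K l ->
  (disc_conf_flat n K l <->
   forall v0 : V, interior_vertex R n K v0 -> link_polytope_cond n K l v0).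
Proof.
move=> KM; split=> [flat|pol] v0 iv0; have [T topsT] := link_tops_exist KM iv0.1.
  have [L [dL delL eL]] := flat v0 iv0; exact (flat_star_link KM topsT dL delL eL).
exact (polytope_flat_star KM topsT iv0 (pol v0 iv0)).
Qed.
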